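(* (i) Let $0\leq\alpha\leq 1/4$. Let $A=\{a_1<a_2<\cdots\}$ and $B=\{b_1<b_2<\cdots\}$ be two infinite subsets of $\mathbb{N}$ such that $a_i-b_i=o\big(a_i^{\frac12-\alpha}\big)$ as $i\to+\infty$, and $A(n)-B(n)=O(n^{\alpha})$ for all $n\geq 1$. Then there is no constant $c>0$ for which $$\sum_{j\leq n}\big(R_{A,B}(j)-cj\big)^2=o\big(n^{\frac32}\big)\qquad\text{as } n\to\infty .$$ (ii) Let $0<\beta\leq 1/2$ and $0\leq\alpha\leq\beta/2$, and let $k\geq 3$ be an integer. Let $A_1,\ldots,A_k$ be non-empty subsets of $\mathbb{N}$ such that $a_{1,i}-a_{2,i}=o\big(a_{1,i}^{\beta-\alpha}\big)$ as $i\to+\infty$, where $a_{1,i}$ (resp. $a_{2,i}$) is the $i$-th element of $A_1$ (resp. $A_2$); $A_1(n)-A_2(n)=O(n^{\alpha})$ for all $n\geq 1$; and $A_1(n)=\Theta(n^{\beta})$. Then there is no constant $c>0$ for which $$\sum_{j\leq n}\big(R_{A_1,\ldots,A_k}(j)-cj\big)^2=o\big(n^{\frac32}\big)\qquad\text{as } n\to\infty .$$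
   Context: $\mathbb{N}$ denotes the set of nonnegative integers; sums over $j\leq n$ run over nonnegative integers $j$. For a set $A\subseteq\mathbb{N}$ and $n\in\mathbb{N}$, $A(n)=|\{a\in A: a\leq n\}|$. The elements of a set are listed in increasing order, so the $i$-th element is the $i$-th smallest (in (ii) the hypotheses force $A_1$ and $A_2$ to be infinite). For $A_1,\ldots,A_k\subseteq\mathbb{N}$, $R_{A_1,\ldots,A_k}(n)=|\{(a_1,\ldots,a_k): a_1\in A_1,\ldots,a_k\in A_k,\ a_1+\cdots+a_k\leq n\}|$; in particular $R_{A,B}(n)=|\{(a,b): a\in A,\ b\in B,\ a+b\leq n\}|$. The notation $f=\Theta(g)$ means that there exist constants $c_1,c_2>0$ such that $c_1g(n)\leq f(n)\leq c_2g(n)$ for all sufficiently large $n$. *)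

(* Defs.v *)
From mathcomp Require Import all_boot all_order all_algebra.
From mathcomp Require Import all_classical all_reals all_analysis.
Import Order.TTheory GRing.Theory Num.Theory.
Import numFieldNormedType.Exports.

Set Implicit Arguments.
Unset Strict Implicit.
Unset Printing Implicit Defensive.

Local Open Scope classical_set_scope.
Local Open Scope ring_scope.

Definition count_upto (A : set nat) (n : nat) : nat :=
  #|[pred a : 'I_n.+1 | (a : nat) \in A]|.

(* The i-th smallest element of A, counting from i = 1; the value is the
   default 0 when i = 0 or when A has fewer than i elements. *)
Definition nth_elt (A : set nat) (i : nat) : nat :=
  xget 0%N [set a | A a /\ count_upto A a = i].

(* Restricting the coordinates to 'I_n.+1 loses no tuple, since natural numbers
   with sum at most n are each at most n. *)
Definition rep_count (k : nat) (A : 'I_k -> set nat) (n : nat) : nat :=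
  #|[pred a : {ffun 'I_k -> 'I_n.+1} |
      [forall i, (a i : nat) \in A i] && (\sum_i (a i : nat) <= n)%N]|.

Definition rep_count2 (A B : set nat) : nat -> nat :=
  rep_count (tnth [tuple A; B]).

Definition sq_error (R : realType) (r : nat -> nat) (c : R) (n : nat) : R :=
  \sum_(j < n.+1) ((r j)%:R - c * j%:R) ^+ 2.

(* Main.v *)
Require Import Defs.
From mathcomp Require Import all_boot all_order all_algebra.
From mathcomp Require Import all_classical all_reals all_analysis.
From mathcomp Require cyclic separable cyclotomic.
From mathcomp Require Import complex.
From mathcomp Require Import ring lra zify.
Import Order.TTheory GRing.Theory Num.Theory.
Import numFieldNormedType.Exports.

Set Implicit Arguments.
Unset Strict Implicit.
Unset Printing Implicit Defensive.

Local Open Scope classical_set_scope.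
Local Open Scope ring_scope.

(** Why the theorem holds.  Let F_i be the generating function of A_i, let
    H = F_3...F_k, and let R be the counting function of the representations.
    The coefficients of P = F_1 F_2 H are the differences of R, so with
    V = sum_n (R(n) - cn) X^n one has P = c X/(1 - X) + (1 - X) V.  Let
    h = 1 + X + ... + X^(M-1), let s = (F_1 + F_2) h and e = (F_1 - F_2) h, so
    that 4 P h^2 = (s^2 - e^2) H, and apply the Euler operator
    theta = X d/dX to this identity:

      s (2 theta(s) H + s theta(H))
        = 4 theta(P h^2) + e (2 theta(e) H + e theta(H)).

    The mean of the absolute value of the left-hand side on a circle
    |z| = r does not change when the outer factor s is replaced by its complex
    conjugate.  Then every coefficient involved is nonnegative, and the mean is
    at least the contribution of the diagonal, where the same element of A_1 is
    used in both copies of s: see [diagonal_lower_bound].  On the right-hand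
    side only the Cauchy-Schwarz inequality and Parseval's formula are needed.
    The derivative of X/(1 - X) is 1/(1 - X)^2, the square of a series to which
    Parseval's formula applies.
    The undifferentiated identity would involve the mean of 1/|1 - z|, which
    costs the logarithm of the classical Erdos-Fuchs theorem.  In the term with
    V, the product (1 - X) h = 1 - X^M is bounded, so the mean-square hypothesis
    enters through the norms of V and theta(V).  See [circle_inequality].

    Take 1 - r of order 1/N.  The coefficients of e are differences of window
    counts of A_1 and A_2, bounded by O(N^alpha), and the sum of their absolute
    values is o(N^(2 beta - alpha)), because |A_1(n) - A_2(n)| summed over n
    is at most the sum of |a_{1,i} - a_{2,i}|.  Hence the norm of e is
    o(N^beta).  The counting functions of A_1 and A_2 and the partial sums
    H(N) of the coefficients of H have a product of order N, so H(N) has order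
    N^(1 - 2 beta), and the e-terms are o(N^2).  The diagonal is at least a constant
    times N M (A_1(KN) - A_1(N)) H(M/2), of order N M N^beta M^(1 - 2 beta).
    With N = (q M)^2 all of this reads, after division by N M^2,

      q^(2 beta) <= constant + o(q^2)    as M tends to infinity,

    with a constant that does not depend on q, which is absurd for a large
    fixed q.  This is [scale_inequality] and [no_small_error].

    Part (i) is the case of two sets and beta = 1/2: there R(n) ~ cn and
    R(n) <= A(n) B(n) <= R(3n) force A(n) to have order n^(1/2), see
    [sqrt_order_of_product].

    In the formal proof all power series are truncated at a degree T chosen
    after every other parameter, so that r^T makes the errors of truncation
    negligible, and the mean over a circle is the average over sufficiently
    many roots of unity, for which Parseval's formula is exact on polynomials. *)

(** * Means over a circle *)

(** [X^n - 1] is separable in characteristic 0, hence has [n] distinct roots,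
    and a finite group of roots of unity in a field is cyclic. *)
Lemma prim_root_exists (C : numClosedFieldType) (n : nat) :
  (0 < n)%N -> exists w : C, n.-primitive_root w.
Proof.
move=> n_gt0; pose p : {poly C} := 'X^n - 1.
have [r Dp] := closed_field_poly_normal p.
move: Dp; rewrite (monicP _) ?monicXnsubC // scale1r => Dp.
have rn1 : all n.-unity_root r by apply/allP => z; rewrite -root_prod_XsubC -Dp.
have sz_r : (n < (size r).+1)%N.
  by rewrite -(size_prod_XsubC r id) -Dp size_XnsubC.
have ur : uniq r.
  rewrite -separable.separable_prod_XsubC -Dp.
  by rewrite cyclotomic.separable_Xn_sub_1 // pnatr_eq0 -lt0n.
have [z zr prim_z] := hasP (cyclic.has_prim_root n_gt0 rn1 ur sz_r).
by exists z.
Qed.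

(** Distinct monomials of degree below [n] are orthogonal for the average over
    the [n]-th roots of unity, so the discrete Parseval formula is exact here. *)
Lemma parseval_roots (C : numClosedFieldType) (n : nat) (w r : C)
    (p q : {poly C}) :
  n.-primitive_root w -> r \is Num.real ->
  (size p <= n)%N -> (size q <= n)%N ->
  \sum_(j < n) (p.[r * w ^+ j])^* * q.[r * w ^+ j] =
  n%:R * \sum_(i < n) (p`_i)^* * q`_i * r ^+ (2 * i).
Proof.
move=> pw rr sp sq; have n0 : (0 < n)%N := prim_order_gt0 pw.
have wn1 : w ^+ n = 1 := prim_expr_order pw.
have nw : `|w| = 1.
  apply/eqP; rewrite -(pexpr_eq1 (n := n)) ?normr_ge0 ?lt0n -?lt0n //.
  by rewrite -normrX wn1 normr1.
have wcw : w^* * w = 1 by rewrite mulrC -normCK nw expr1n.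
have orth (a b : 'I_n) :
    \sum_(j < n) (w^* ^+ a * w ^+ b) ^+ j = if a == b then n%:R else 0.
  case: eqVneq => [<-|ab].
    rewrite (eq_bigr (fun=> 1)) ?sumr_const ?card_ord // => j _.
    by rewrite -exprMn wcw !expr1n.
  set z := w^* ^+ a * w ^+ b.
  have z1 : z != 1.
    apply: contra_neq ab => zE.
    have : w ^+ a = w ^+ b.
      have := congr1 (fun x => w ^+ a * x) zE.
      by rewrite /z mulr1 mulrA -exprMn (mulrC w) wcw expr1n mul1r.
    move/eqP; rewrite (eq_prim_root_expr pw) !modn_small // => /eqP ?.
    exact: val_inj.
  have zn : z ^+ n = 1.
    by rewrite /z exprMn -!exprM !(mulnC _ n) !exprM wn1 -rmorphXn wn1 rmorph1 !expr1n mul1r.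
  apply/eqP; have /eqP := subrX1 z n; rewrite zn subrr eq_sym mulf_eq0.
  by rewrite subr_eq0 (negbTE z1).
have ev (s : {poly C}) (x : C) : (size s <= n)%N -> s.[x] = \sum_(i < n) s`_i * x ^+ i.
  by move=> ss; apply: horner_coef_wide.
transitivity (\sum_(j < n) \sum_(a < n) \sum_(b < n)
   ((p`_a)^* * q`_b * r ^+ (a + b)) * (w^* ^+ a * w ^+ b) ^+ j).
  apply: eq_bigr => j _; rewrite !ev // rmorph_sum /= mulr_suml.
  apply: eq_bigr => a _; rewrite mulr_sumr; apply: eq_bigr => b _.
  rewrite !rmorphM !rmorphXn /= rmorphM /= rmorphXn /= (CrealP rr).
  rewrite !exprMn -!exprM !(mulnC j) exprD.
  by rewrite -!mulrA; congr (_ * _); ring.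
rewrite exchange_big /= mulr_sumr; apply: eq_bigr => a _.
rewrite exchange_big /= (bigD1 a) //= [X in _ + X]big1 ?addr0.
  by rewrite -mulr_sumr orth eqxx mulrC mul2n addnn.
by move=> b ba; rewrite -mulr_sumr orth eq_sym (negbTE ba) mulr0.
Qed.

(** Norms of the coefficient sequence of [p(rX)]. [wnorm2] is the square of the
    l2 norm, that is, the mean of [|p|^2] on the circle of radius [r]. *)
Definition wnorm1 (R : realType) (r : R) (p : {poly R}) : R :=
  \sum_(i < size p) `|p`_i| * r ^+ i.
Definition wnorm2 (R : realType) (r : R) (p : {poly R}) : R :=
  \sum_(i < size p) p`_i ^+ 2 * r ^+ (2 * i).

Lemma wnorm1E (R : realType) (r : R) (p : {poly R}) n : (size p <= n)%N ->
  wnorm1 r p = \sum_(i < n) `|p`_i| * r ^+ i.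
Proof.
move=> sp; rewrite /wnorm1 (big_ord_widen n (fun i => `|p`_i| * r ^+ i)) //.
rewrite big_mkcond; apply: eq_bigr => i _; case: ltnP => // ip.
by rewrite nth_default // normr0 mul0r.
Qed.

Lemma wnorm2E (R : realType) (r : R) (p : {poly R}) n : (size p <= n)%N ->
  wnorm2 r p = \sum_(i < n) p`_i ^+ 2 * r ^+ (2 * i).
Proof.
move=> sp; rewrite /wnorm2 (big_ord_widen n (fun i => p`_i ^+ 2 * r ^+ (2 * i))) //.
rewrite big_mkcond; apply: eq_bigr => i _; case: ltnP => // ip.
by rewrite nth_default // expr0n mul0r.
Qed.

(** The functional is the mean of [|p|] over the points [r * w ^+ j], where [w] is
    a primitive [n]-th root of unity. The last property holds because [|p q|] is
    also the modulus of [conj(p) q], whose mean is the scalar product of the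
    coefficient sequences. These five properties contain all the Fourier
    analysis of the proof. *)
Lemma circle_mean (R : realType) (r : R) (n : nat) : 0 <= r -> (0 < n)%N ->
  exists avg : {poly R} -> R,
  [/\ (forall p q, avg (p + q) <= avg p + avg q),
      (forall p, avg (- p) = avg p),
      (forall p q, avg (p * q) <= wnorm1 r p * avg q),
      (forall (p q : {poly R}) a b, (size p <= n)%N -> (size q <= n)%N -> 0 <= a -> 0 <= b ->
         wnorm2 r p <= a ^+ 2 -> wnorm2 r q <= b ^+ 2 -> avg (p * q) <= a * b) &
      (forall (p q : {poly R}), (size p <= n)%N -> (size q <= n)%N ->
         \sum_(i < n) p`_i * q`_i * r ^+ (2 * i) <= avg (p * q))].
Proof.
move=> r0 n0; have [w pw] := prim_root_exists (complex.complex R) n0.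
pose f : {rmorphism R -> complex.complex R} := complex.real_complex R.
pose x (j : 'I_n) := f r * w ^+ j.
have fle a b : (f a <= f b) = (a <= b) by exact: complex.lecR.
have fRe a : f a \is Num.real by apply/complex.complex_realP; exists a.
pose nc (z : complex.complex R) : R := complex.Re `|z|.
have ncE z : f (nc z) = `|z| by apply: complex.RRe_real; exact: normr_real.
have nc_ge0 z : 0 <= nc z by rewrite -fle ncE rmorph0.
have ncD a b : nc (a + b) <= nc a + nc b.
  by rewrite -fle rmorphD !ncE ler_normD.
have ncM a b : nc (a * b) = nc a * nc b.
  by apply: complex.complexI; rewrite -/f rmorphM !ncE normrM.
pose ev p j := (map_poly f p).[x j].
pose avg p := n%:R^-1 * \sum_(j < n) nc (ev p j).
have ninv : 0 <= n%:R^-1 :> R by rewrite invr_ge0 ler0n.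
have nn0 : n%:R != 0 :> R by rewrite pnatr_eq0 -lt0n.
have ncsum (I : Type) (s : seq I) (P : pred I) F :
    nc (\sum_(i <- s | P i) F i) <= \sum_(i <- s | P i) nc (F i).
  elim/big_rec2: _ => [|i a b _ IH]; first by rewrite /nc normr0.
  by apply: le_trans (ncD _ _) _; rewrite lerD2l.
have nw : `|w| = 1.
  apply/eqP; rewrite -(pexpr_eq1 (n := n)) ?normr_ge0 //.
  by rewrite -normrX (prim_expr_order pw) normr1.
have ncx j : nc (x j) = r.
  apply: complex.complexI; rewrite -/f ncE /x normrM normrX nw expr1n mulr1.
  by rewrite ger0_norm // -(rmorph0 f) fle.
have ncX z i : nc (z ^+ i) = nc z ^+ i.
  elim: i => [|i IH]; first by rewrite !expr0 /nc normr1.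
  by rewrite !exprS ncM IH.
have ncf a : nc (f a) = `|a|.
  apply: complex.complexI; rewrite -/f ncE.
  case: (lerP 0 a) => a0.
    by rewrite !ger0_norm // -(rmorph0 f) fle.
  have fa0 : f a < 0 by rewrite -(rmorph0 f) complex.ltcR.
  by rewrite (ltr0_norm a0) (ltr0_norm fa0) rmorphN.
have evM p q j : ev (p * q) j = ev p j * ev q j by rewrite /ev rmorphM hornerM.
have ev1 p j : nc (ev p j) <= wnorm1 r p.
  rewrite /ev (horner_coef_wide _ (n := size p)) ?size_map_inj_poly //; last first.
  - exact: complex.complexI.
  apply: le_trans (ncsum _ _ _ _) _; apply: ler_sum => i _.
  by rewrite ncM ncX ncx coef_map /= ncf.
have pars (p q : {poly R}) : (size p <= n)%N -> (size q <= n)%N ->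
    \sum_(j < n) (ev p j)^* * ev q j =
    f (n%:R * \sum_(i < n) p`_i * q`_i * r ^+ (2 * i)).
  move=> sp sq; rewrite /ev /x (parseval_roots pw) ?fRe //; last 2 first.
  - by rewrite size_map_inj_poly ?rmorph0 //; exact: complex.complexI.
  - by rewrite size_map_inj_poly ?rmorph0 //; exact: complex.complexI.
  rewrite rmorphM rmorph_nat; congr (_ * _).
  rewrite rmorph_sum; apply: eq_bigr => i _.
  rewrite !coef_map /= (CrealP (fRe _)).
  by rewrite !rmorphM rmorphXn.
have nc2 (p : {poly R}) : (size p <= n)%N -> \sum_(j < n) nc (ev p j) ^+ 2 = n%:R * wnorm2 r p.
  move=> sp; apply: complex.complexI; rewrite -/f (wnorm2E r sp).
  under [X in f (_ * X)]eq_bigr => i _ do rewrite expr2.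
  rewrite -pars // rmorph_sum; apply: eq_bigr => j _.
  by rewrite rmorphXn ncE normCK mulrC.
exists avg; split.
- move=> p q; rewrite -mulrDr ler_wpM2l // -big_split /=.
  by apply: ler_sum => j _; rewrite /ev rmorphD hornerD ncD.
- move=> p; congr (_ * _); apply: eq_bigr => j _.
  by rewrite /ev rmorphN hornerN /nc normrN.
- move=> p q; rewrite mulrCA ler_wpM2l // mulr_sumr.
  by apply: ler_sum => j _; rewrite evM ncM ler_wpM2r.
- move=> p q a b sp sq a0 b0 pa qb.
  have amgm (u v : R) : 0 < u -> 0 < v -> a <= u -> b <= v -> avg (p * q) <= u * v.
    move=> u0 v0 au bv.
    have step : \sum_(j < n) nc (ev (p * q) j) <=
       \sum_(j < n) 2^-1 * (v / u * nc (ev p j) ^+ 2 + u / v * nc (ev q j) ^+ 2).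
      apply: ler_sum => j _; rewrite evM ncM.
      move: (nc (ev p j)) (nc (ev q j)) => y z.
      rewrite -subr_ge0.
      suff -> : 2^-1 * (v / u * y ^+ 2 + u / v * z ^+ 2) - y * z =
        2^-1 * (u * v)^-1 * (v * y - u * z) ^+ 2.
        by rewrite mulr_ge0 ?sqr_ge0 // mulr_ge0 ?invr_ge0 ?mulr_ge0 // ltW.
      by field; rewrite ?gt_eqF.
    rewrite /avg ler_pdivrMl ?ltr0n //; apply: le_trans step _.
    rewrite -mulr_sumr big_split /= -!mulr_sumr !nc2 //.
    have le1 : wnorm2 r p <= u ^+ 2.
      by apply: le_trans pa _; rewrite ler_sqr ?nnegrE // ltW.
    have le2 : wnorm2 r q <= v ^+ 2.
      by apply: le_trans qb _; rewrite ler_sqr ?nnegrE // ltW.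
    have -> : n%:R * (u * v) = 2^-1 * (v / u * (n%:R * u ^+ 2) + u / v * (n%:R * v ^+ 2)) :> R.
      by field; rewrite ?gt_eqF.
    apply: ler_wpM2l; first by rewrite invr_ge0.
    have vu : 0 <= v / u by apply: divr_ge0; exact: ltW.
    have uv : 0 <= u / v by apply: divr_ge0; exact: ltW.
    by apply: lerD; apply: ler_wpM2l => //; apply: ler_wpM2l.
  apply/ler_addgt0Pr => e e0.
  have d0 : 0 < a + b + 1 + e by rewrite -addrA ltr_wpDl ?addr_ge0 // addr_gt0.
  pose u := e / (a + b + 1 + e).
  have u0 : 0 < u by rewrite divr_gt0.
  have u1 : u <= 1 by rewrite ler_pdivrMr // mul1r lerDr !addr_ge0.
  have ue : u * (a + b + 1) <= e.
    rewrite /u mulrAC ler_pdivrMr // ler_pM2l //; lra.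
  apply: le_trans (amgm (a + u) (b + u) _ _ _ _) _; try lra.
  nra.
- move=> p q sp sq; rewrite /avg ler_pdivlMl ?ltr0n //.
  rewrite -fle -pars //; apply: le_trans (_ : `|\sum_(j < n) (ev p j)^* * ev q j| <= _).
    apply: real_ler_norm; rewrite pars //.
  apply: le_trans (ler_norm_sum _ _ _) _.
  rewrite rmorph_sum; apply: ler_sum => j _.
  by rewrite evM ncE !normrM norm_conjC.
Qed.

(** * The Euler operator and windows *)

(** The Euler operator: it multiplies the coefficient of degree [i] by [i], and so
    puts the weight on the coefficients of large degree. *)
Definition theta (R : nzRingType) (p : {poly R}) : {poly R} := 'X * p^`().

Lemma coef_theta (R : nzRingType) (p : {poly R}) i : (theta p)`_i = p`_i *+ i.
Proof. by rewrite /theta coefXM; case: i => [|i] //=; rewrite coef_deriv. Qed.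

Lemma size_theta (R : nzRingType) (p : {poly R}) : (size (theta p) <= size p)%N.
Proof.
by apply/leq_sizeP => j pj; rewrite coef_theta nth_default // mul0rn.
Qed.

Lemma thetaD (R : nzRingType) (p q : {poly R}) : theta (p + q) = theta p + theta q.
Proof. by rewrite /theta derivD mulrDr. Qed.

Lemma thetaN (R : nzRingType) (p : {poly R}) : theta (- p) = - theta p.
Proof. by rewrite /theta derivN mulrN. Qed.

Lemma thetaM (R : comNzRingType) (p q : {poly R}) :
  theta (p * q) = theta p * q + p * theta q.
Proof. by rewrite /theta derivM; ring. Qed.

Lemma thetaC (R : nzRingType) (c : R) : theta c%:P = 0.
Proof. by rewrite /theta derivC mulr0. Qed.

Lemma thetaXn (R : comNzRingType) n : theta ('X^n : {poly R}) = n%:R%:P * 'X^n.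
Proof.
apply/polyP => i; rewrite coef_theta coefCM !coefXn.
by case: eqP => [->|]; rewrite ?mulr1 // mulr0 mul0rn.
Qed.

(** Multiplication by this polynomial replaces each coefficient by the sum of the
    [M] consecutive coefficients that end there. *)
Definition window (R : nzRingType) (M : nat) : {poly R} := \poly_(i < M) 1.

Lemma window_telescope (R : comNzRingType) M :
  (1 - 'X) * window R M = 1 - 'X^M.
Proof.
rewrite /window poly_def (eq_bigr (fun i : 'I_M => 'X^i)) => [|i _].
  by rewrite -opprB mulNr -subrX1 opprB.
by rewrite scale1r.
Qed.

Lemma wnorm1_ge0 (R : realType) (r : R) p : 0 <= r -> 0 <= wnorm1 r p.
Proof. by move=> r0; apply: sumr_ge0 => i _; rewrite mulr_ge0 ?exprn_ge0. Qed.

Lemma wnorm1C (R : realType) (r c : R) : wnorm1 r c%:P = `|c|.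
Proof.
by rewrite (wnorm1E r (size_polyC_leq1 c)) big_ord1 coefC /= expr0 mulr1.
Qed.

Lemma wnorm1Xn (R : realType) (r : R) n : wnorm1 r 'X^n = r ^+ n.
Proof.
rewrite /wnorm1 size_polyXn (bigD1 ord_max) //= big1 => [|i ni].
  by rewrite coefXn eqxx normr1 mul1r addr0.
rewrite coefXn; case: eqP => [E|]; last by rewrite normr0 mul0r.
by case/eqP: ni; apply: val_inj.
Qed.

Lemma wnorm1_theta (R : realType) (r : R) (p : {poly R}) n : 0 <= r ->
  (size p <= n)%N -> wnorm1 r (theta p) <= n%:R * wnorm1 r p.
Proof.
move=> r0 sp; rewrite (wnorm1E r (leq_trans (size_theta p) sp)) (wnorm1E r sp).
rewrite mulr_sumr; apply: ler_sum => i _.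
rewrite coef_theta normrMn -(mulr_natl `|p`_i|) -mulrA; apply: ler_wpM2r.
  by rewrite mulr_ge0 ?exprn_ge0.
by rewrite ler_nat ltnW.
Qed.

Lemma wnorm2_theta (R : realType) (r : R) (p : {poly R}) n : 0 <= r ->
  (size p <= n)%N -> wnorm2 r (theta p) <= n%:R ^+ 2 * wnorm2 r p.
Proof.
move=> r0 sp; rewrite (wnorm2E r (leq_trans (size_theta p) sp)) (wnorm2E r sp).
rewrite mulr_sumr; apply: ler_sum => i _.
rewrite coef_theta -(mulr_natl p`_i) exprMn -mulrA; apply: ler_wpM2r.
  by apply: mulr_ge0; [exact: sqr_ge0|exact: exprn_ge0].
by rewrite ler_sqr ?nnegrE ?ler0n // ler_nat ltnW.
Qed.

Lemma wnorm1_window (R : realType) (r : R) M : 0 <= r <= 1 ->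
  wnorm1 r (window R M) <= M%:R.
Proof.
move=> /andP[r0 r1]; rewrite (wnorm1E r (size_poly _ _)).
rewrite -[M in M%:R]card_ord -sumr_const; apply: ler_sum => i _.
by rewrite coef_poly ltn_ord normr1 mul1r exprn_ile1.
Qed.

Lemma wnorm2_window (R : realType) (r : R) M : 0 <= r <= 1 ->
  wnorm2 r (window R M) <= M%:R.
Proof.
move=> /andP[r0 r1]; rewrite (wnorm2E r (size_poly _ _)).
rewrite -[M in M%:R]card_ord -sumr_const; apply: ler_sum => i _.
by rewrite coef_poly ltn_ord expr1n mul1r exprn_ile1.
Qed.

Lemma coefM_ge0 (R : realType) (p q : {poly R}) :
  (forall i, 0 <= p`_i) -> (forall i, 0 <= q`_i) -> forall i, 0 <= (p * q)`_i.
Proof.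
by move=> p0 q0 i; rewrite coefM; apply: sumr_ge0 => j _; rewrite mulr_ge0.
Qed.

(** * The inequality on the circle *)

Lemma leq_size_sum (R : nzRingType) (l : seq {poly R}) p :
  p \in l -> (size p <= \sum_(q <- l) size q)%N.
Proof. by move=> pl; rewrite (big_rem p) //= leq_addr. Qed.

(** With [s] and [e] the products of [S] and [E] by the window [h], the identity
    [(S^2 - E^2) H = 4 P] gives
    [s (2 theta s H + s theta H) = 4 theta (P h^2) + e (2 theta e H + e theta H)].
    The mean of the left-hand side over the circle is bounded below by a scalar
    product of nonnegative sequences, and the right-hand side is expanded by
    Leibniz until each term is a product of two factors to which the
    Cauchy-Schwarz inequality applies. The polynomials [T] and [T'] stand for
    the errors of truncation. *)
Lemma circle_inequality (R : realType) (r c mu g v v1 t0 t1 e e1 a a1 : R) (M : nat)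
    (S E H P V T J G T' : {poly R}) :
  0 <= r <= 1 -> 0 <= c -> 0 <= mu -> mu ^+ 2 = M%:R ->
  0 <= g -> 0 <= v -> 0 <= v1 -> 0 <= e -> 0 <= e1 ->
  (S ^+ 2 - E ^+ 2) * H = 4%:R%:P * P ->
  P = c%:P * J + (1 - 'X) * V + T ->
  theta J = 'X * G ^+ 2 - T' ->
  wnorm2 r G <= g ^+ 2 -> wnorm2 r J <= g ^+ 2 ->
  wnorm2 r V <= v ^+ 2 -> wnorm2 r (theta V) <= v1 ^+ 2 ->
  wnorm1 r T' <= t0 -> wnorm1 r (theta (T * window R M ^+ 2)) <= t1 ->
  wnorm2 r (E * window R M) <= e ^+ 2 ->
  wnorm2 r (theta (E * window R M)) <= e1 ^+ 2 ->
  wnorm1 r H <= a -> wnorm1 r (theta H) <= a1 ->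
  (forall i, 0 <= S`_i) -> (forall i, 0 <= H`_i) ->
  let s := S * window R M in
  forall n, 2 * (\sum_(i < n) s`_i * (theta s * H)`_i * r ^+ (2 * i)) <=
  4 * (c * (M%:R ^+ 2 * g ^+ 2 + M%:R ^+ 2 * t0 + 2 * (M%:R ^+ 2 * (g * mu)))
       + (3 * (M%:R * mu * v) + 2 * (mu * v1)) + t1)
  + (2 * (a * (e * e1)) + a1 * e ^+ 2).
Proof.
move=> r01 c0 mu0 muM g0 v0 v10 e0 e10 PE PV JE nG nJ nV nV1 nT' nT nE nE1 nH nH1 S0 H0 s n.
have [r0 r1] := andP r01.
set h := window R M in nT nE nE1 s *.
pose w := 2%:R%:P * theta s * H + s * theta H.
(* The number [Q] of sample points exceeds the size of every polynomial to
   which Parseval's formula is applied. *)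
pose L : seq {poly R} := [:: s; w; h; theta h; G; J; V; theta V; E * h; theta (E * h)].
pose Q := (n + \sum_(p <- L) size p).+1.
have [avg [avgD avgN avgM avg2 avgge]] := circle_mean r0 (ltn0Sn _ : 0 < Q)%N.
have avg_ge0 p : 0 <= avg p.
  have z : 0 <= avg (p - p).
    have := avgge 0 0; rewrite size_poly0 mul0r subrr => /(_ isT isT); apply: le_trans.
    by apply: sumr_ge0 => i _; rewrite coef0 !mul0r.
  by have := avgD p (- p); rewrite avgN; lra.
have norm1 : wnorm2 r (1 : {poly R}) <= 1 ^+ 2.
  by rewrite -[1 : {poly R}]/(1%:P) (wnorm2E r (size_polyC_leq1 1)) big_ord1 coefC /= !expr1n mulr1.
have avg1 : avg 1 <= 1.
  have : avg (1 * 1) <= 1 * 1 by apply: avg2; rewrite ?size_poly1.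
  by rewrite !mulr1.
have avgMle p q x y : wnorm1 r p <= x -> avg q <= y -> avg (p * q) <= x * y.
  by move=> px qy; apply: le_trans (avgM _ _) _; apply: ler_pM => //; exact: wnorm1_ge0.
have avg_le p x : wnorm1 r p <= x -> avg p <= x.
  by move=> px; rewrite -[p]mulr1 -[x]mulr1; exact: avgMle.
have avgXn k p : avg ('X^k * p) <= avg p.
  by rewrite -[leRHS]mul1r; apply: avgMle; rewrite // wnorm1Xn exprn_ile1.
have avgX p : avg ('X * p) <= avg p by exact: avgXn 1%N p.
have avgC x p : 0 <= x -> avg (x%:P * p) <= x * avg p.
  by move=> x0; apply: avgMle => //; rewrite wnorm1C ger0_norm.
have h1 : wnorm1 r h <= M%:R by exact: wnorm1_window.
have h2 : wnorm2 r h <= mu ^+ 2 by rewrite muM; exact: wnorm2_window.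
have sh : (size h <= M)%N by exact: size_poly.
have th1 : wnorm1 r (theta h) <= M%:R ^+ 2.
  by apply: le_trans (wnorm1_theta r0 sh) _; rewrite expr2 ler_wpM2l.
have th2 : wnorm2 r (theta h) <= (M%:R * mu) ^+ 2.
  by apply: le_trans (wnorm2_theta r0 sh) _; rewrite exprMn ler_wpM2l ?exprn_ge0.
have M0 : 0 <= M%:R :> R by [].
have szQ p : p \in L ->
    (size p <= Q)%N.
  by move=> pin; rewrite /Q ltnW // ltnS (leq_trans (leq_size_sum pin)) ?leq_addl.
have mem k : (k < size L)%N -> (size (nth 0%R L k) <= Q)%N.
  by move=> k10; apply/szQ/mem_nth.
have [Qs Qw Qh Qth] := And4 (mem 0 isT) (mem 1 isT) (mem 2 isT) (mem 3 isT).
have [QG QJ QV QtV] := And4 (mem 4 isT) (mem 5 isT) (mem 6 isT) (mem 7 isT).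
have [QE QtE] := conj (mem 8 isT) (mem 9 isT).
rewrite /L /= in Qs Qw Qh Qth QG QJ QV QtV QE QtE.
have UJ : avg (theta (J * h ^+ 2)) <=
    M%:R ^+ 2 * g ^+ 2 + M%:R ^+ 2 * t0 + 2 * (M%:R ^+ 2 * (g * mu)).
  have -> : theta (J * h ^+ 2) =
      'X * (h * (h * (G * G))) + - (h * (h * T')) + 2%:R%:P * (theta h * (J * h)).
    by rewrite expr2 !thetaM JE polyC_natr; ring.
  apply: le_trans (avgD _ _) _; apply: lerD.
    apply: le_trans (avgD _ _) _; apply: lerD.
      apply: le_trans (avgX _) _; rewrite !expr2 -mulrA.
      by do 2 apply: (avgMle) => //; exact: avg2.
    rewrite avgN expr2 -mulrA.
    by do 2 apply: (avgMle) => //; exact: avg_le.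
  apply: le_trans (avgC _ _ _) _ => //; rewrite ler_pM2l //.
  by apply: avgMle => //; exact: avg2.
have UV : avg (theta ((1 - 'X) * V * h ^+ 2)) <= 3 * (M%:R * mu * v) + 2 * (mu * v1).
  have -> : (1 - 'X) * V * h ^+ 2 = (1 - 'X^M) * (h * V).
    by rewrite -window_telescope -/h; ring.
  have -> : theta ((1 - 'X^M) * (h * V)) =
      (- (M%:R%:P * ('X^M * (h * V))) + (theta h * V + - ('X^M * (theta h * V))))
      + (h * theta V + - ('X^M * (h * theta V))).
    rewrite !thetaM thetaD thetaN thetaXn -[1]/(1%:P) thetaC; ring.
  have b1 : avg (h * V) <= mu * v by exact: avg2.
  have b2 : avg (theta h * V) <= M%:R * mu * v by apply: avg2 => //; exact: mulr_ge0.
  have b3 : avg (h * theta V) <= mu * v1 by exact: avg2.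
  have b4 := avgXn M (theta h * V).
  have b5 := avgXn M (h * theta V).
  have b6 := avgXn M (h * V).
  have b7 : avg (M%:R%:P * ('X^M * (h * V))) <= M%:R * (mu * v).
    by apply: avgMle; rewrite ?wnorm1C ?ger0_norm //; apply: le_trans b6 _.
  have c1 := avgD
    (- (M%:R%:P * ('X^M * (h * V))) + (theta h * V + - ('X^M * (theta h * V))))
    (h * theta V + - ('X^M * (h * theta V))).
  have c2 := avgD (- (M%:R%:P * ('X^M * (h * V)))) (theta h * V + - ('X^M * (theta h * V))).
  have c3 := avgD (theta h * V) (- ('X^M * (theta h * V))).
  have c4 := avgD (h * theta V) (- ('X^M * (h * theta V))).
  rewrite !avgN in c1 c2 c3 c4; lra.
have UP : avg (theta (P * h ^+ 2)) <=
   c * (M%:R ^+ 2 * g ^+ 2 + M%:R ^+ 2 * t0 + 2 * (M%:R ^+ 2 * (g * mu)))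
       + (3 * (M%:R * mu * v) + 2 * (mu * v1)) + t1.
  have -> : theta (P * h ^+ 2) =
     c%:P * theta (J * h ^+ 2) + theta ((1 - 'X) * V * h ^+ 2) + theta (T * h ^+ 2).
    rewrite PV !mulrDl !thetaD; congr (_ + _ + _).
    by rewrite -mulrA thetaM thetaC mul0r add0r.
  apply: le_trans (avgD _ _) _; apply: lerD; last exact: avg_le.
  apply: le_trans (avgD _ _) _; apply: lerD => //.
  by apply: le_trans (avgC _ _ _) _ => //; rewrite ler_wpM2l.
have UE : avg (2%:R%:P * (H * ((E * h) * theta (E * h))) + theta H * ((E * h) * (E * h)))
    <= 2 * (a * (e * e1)) + a1 * e ^+ 2.
  apply: le_trans (avgD _ _) _; apply: lerD.
    apply: le_trans (avgC _ _ _) _ => //; rewrite ler_pM2l //.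
    by apply: avgMle => //; exact: avg2.
  by apply: avgMle => //; rewrite expr2; exact: avg2.
have swE : s * w = 4%:R%:P * theta (P * h ^+ 2) +
   (2%:R%:P * (H * ((E * h) * theta (E * h))) + theta H * ((E * h) * (E * h))).
  have -> : 4%:R%:P * theta (P * h ^+ 2) = theta ((S ^+ 2 - E ^+ 2) * H * h ^+ 2).
    by rewrite PE -mulrA [RHS]thetaM thetaC mul0r add0r.
  have -> : (S ^+ 2 - E ^+ 2) * H * h ^+ 2 = (s * s + - ((E * h) * (E * h))) * H.
    by rewrite /s; ring.
  by rewrite /w (thetaM _ H) thetaD thetaN (thetaM s s) (thetaM (E * h) (E * h)) polyC_natr; ring.
have upper : avg (s * w) <=
  4 * (c * (M%:R ^+ 2 * g ^+ 2 + M%:R ^+ 2 * t0 + 2 * (M%:R ^+ 2 * (g * mu)))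
       + (3 * (M%:R * mu * v) + 2 * (mu * v1)) + t1)
  + (2 * (a * (e * e1)) + a1 * e ^+ 2).
  rewrite swE; apply: le_trans (avgD _ _) _; apply: lerD => //.
  by apply: le_trans (avgC _ _ _) _ => //; rewrite ler_pM2l.
apply: le_trans upper; apply: le_trans (avgge _ _ Qs Qw).
have s0 i : 0 <= s`_i.
  apply: coefM_ge0 => // {}i; rewrite coef_poly; by case: ifP.
have ts0 i : 0 <= (theta s)`_i by rewrite coef_theta mulrn_wge0.
have tH0 i : 0 <= (theta H)`_i by rewrite coef_theta mulrn_wge0.
have wge i : 2 * (theta s * H)`_i <= w`_i.
  by rewrite /w coefD -mulrA coefCM lerDl; exact: coefM_ge0.
rewrite mulr_sumr; apply: (@le_trans _ _ (\sum_(i < n) s`_i * w`_i * r ^+ (2 * i))).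
  apply: ler_sum => i _; rewrite mulrA ler_wpM2r ?exprn_ge0 //.
  by rewrite mulrCA ler_wpM2l.
have nQ : (n <= Q)%N by rewrite /Q ltnW // ltnS leq_addr.
rewrite (big_ord_widen _ (fun i => s`_i * w`_i * r ^+ (2 * i)) nQ) big_mkcond.
apply: ler_sum => i _; case: ifP => // _.
rewrite !mulr_ge0 ?exprn_ge0 //; apply: le_trans (wge i).
by rewrite mulr_ge0 //; exact: coefM_ge0.
Qed.

(** * Exponentially damped sums *)

(** By induction on the degree: with [y] the square root of [x], one factor
    [y ^+ n] absorbs the power of degree [j], and the other one absorbs a single
    factor [n + 1], because [(n + 1) y ^+ n] is at most the geometric series of [y]. *)
Lemma poly_geo_bounded (R : realType) (x : R) (j : nat) : 0 <= x < 1 ->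
  exists2 C, 0 < C & forall n, n.+1%:R ^+ j * x ^+ n <= C.
Proof.
elim: j x => [|j IH] x /andP[x0 x1].
  by exists 1 => // n; rewrite expr0 mul1r exprn_ile1 // ltW.
pose y := Num.sqrt x.
have y0 : 0 <= y by exact: sqrtr_ge0.
have yx : y ^+ 2 = x by rewrite sqr_sqrtr.
have y1 : y < 1 by rewrite -(@ltr_pXn2r _ 2) ?nnegrE // yx expr1n.
have [C C0 HC] := IH y (introT andP (conj y0 y1)).
have y1' : 0 < 1 - y by rewrite subr_gt0.
exists (C * (1 - y)^-1); first by rewrite mulr_gt0 // invr_gt0.
move=> n; rewrite -yx -exprM mul2n -addnn exprD exprS.
rewrite (_ : _ * _ * _ = (n.+1%:R ^+ j * y ^+ n) * (n.+1%:R * y ^+ n)); last by ring.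
apply: ler_pM; rewrite ?mulr_ge0 ?exprn_ge0 //.
rewrite -[leRHS]mul1r ler_pdivlMr //.
have -> : n.+1%:R * y ^+ n = \sum_(i < n.+1) y ^+ n.
  by rewrite sumr_const card_ord mulr_natl.
apply: (@le_trans _ _ ((\sum_(i < n.+1) y ^+ i) * (1 - y))).
  apply: ler_wpM2r; first exact: ltW.
  apply: ler_sum => i _.
  by rewrite ler_wiXn2l // ?ltW // -ltnS.
rewrite mulrC -opprB mulNr -subrX1 opprB gerBl; exact: exprn_ge0.
Qed.

Lemma poly_geo_small (R : realType) (x e : R) (j : nat) : 0 <= x < 1 -> 0 < e ->
  exists n0, forall n, (n0 <= n)%N -> n.+1%:R ^+ j * x ^+ n <= e.
Proof.
move=> x01 e0; have [C C0 HC] := poly_geo_bounded j.+1 x01.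
exists (Num.bound (C / e)) => n n0n.
have ln : C / e < n.+1%:R.
  apply: lt_le_trans (archi_boundP _) _; first by rewrite divr_ge0 ?ltW.
  by rewrite ler_nat; apply: leq_trans n0n _.
have := HC n; rewrite exprS -mulrA => H.
rewrite -(ler_pM2l (ltr0Sn R n)); apply: le_trans H _.
by rewrite -ler_pdivrMr // ltW.
Qed.

(** The weight [rho ^+ n] loses a factor 2 on each block of length [N], while the
    other factors grow polynomially in the index of the block; so bounds at the
    multiples of [N] control the whole weighted sum, with a constant that does
    not depend on [N]. *)
Lemma block_sum (R : realType) (j : nat) : exists2 K : R, 0 < K &
  forall (rho B : R) (N p q : nat) (w : nat -> R),
  0 <= rho <= 1 -> rho ^+ N <= 1 / 2 -> (0 < N)%N -> (forall n, 0 <= w n) ->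
  (p + q)%N = j ->
  (forall m, \sum_(n < m.+1 * N) w n <= m.+1%:R ^+ q * B) ->
  forall T, \sum_(n < T) n%:R ^+ p * w n * rho ^+ n <= K * N%:R ^+ p * B.
Proof.
have [|C C0 HC] := @poly_geo_bounded R (3 / 4) j; first by apply/andP; split; lra.
exists (3 * C) => [|rho B N p q w /andP[r0 r1] rN N0 w0 pq HB T]; first by rewrite mulr_gt0.
have B0 : 0 <= B.
  have := HB 0%N; rewrite expr1n mul1r; apply: le_trans.
  by apply: sumr_ge0.
have geo : forall L, \sum_(m < L) m.+1%:R ^+ j * (1 / 2) ^+ m <= C * (3 - 3 * (2 / 3) ^+ L) :> R.
  elim=> [|L IH]; first by rewrite big_ord0 expr0 mulr1 subrr mulr0.
  rewrite big_ord_recr /=; apply: le_trans (lerD IH (_ : _ <= C * (2 / 3) ^+ L)) _.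
    rewrite (_ : 1 / 2 = 3 / 4 * (2 / 3)); last by field.
    by rewrite exprMn mulrA ler_wpM2r ?exprn_ge0 ?divr_ge0.
  by rewrite exprS -mulrDr ler_pM2l //; lra.
have step : forall L, \sum_(n < L * N) n%:R ^+ p * w n * rho ^+ n <=
   N%:R ^+ p * B * \sum_(m < L) m.+1%:R ^+ j * (1 / 2) ^+ m.
  elim=> [|L IH]; first by rewrite mul0n !big_ord0 mulr0.
  rewrite [in leRHS]big_ord_recr /= mulrDr -(big_mkord xpredT (fun n => n%:R ^+ p * w n * rho ^+ n)).
  rewrite (big_cat_nat (n := L * N)) //=; last by rewrite leq_mul2r leqnSn orbT.
  rewrite big_mkord; apply: lerD => //.
  apply: (@le_trans _ _ (\sum_(L * N <= n < L.+1 * N) (L.+1 * N)%:R ^+ p * w n * (1 / 2) ^+ L)).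
    rewrite !big_nat; apply: ler_sum => n /andP[nl nu].
    apply: ler_pM; rewrite ?mulr_ge0 ?exprn_ge0 //.
      by rewrite ler_wpM2r // lerXn2r ?nnegrE // ler_nat ltnW.
    apply: (@le_trans _ _ (rho ^+ (L * N))); first by rewrite ler_wiXn2l.
    by rewrite mulnC exprM lerXn2r ?nnegrE ?exprn_ge0 ?divr_ge0.
  rewrite -mulr_suml -mulr_sumr.
  have bl : \sum_(L * N <= n < L.+1 * N) w n <= L.+1%:R ^+ q * B.
    apply: le_trans (HB L); rewrite -(big_mkord xpredT w) [leRHS](big_cat_nat (n := L * N)) //=.
      by rewrite lerDr sumr_ge0.
    by rewrite leq_mul2r leqnSn orbT.
  apply: (@le_trans _ _ ((L.+1 * N)%:R ^+ p * (L.+1%:R ^+ q * B) * (1 / 2) ^+ L)).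
    by rewrite ler_wpM2r ?exprn_ge0 ?divr_ge0 // ler_wpM2l ?exprn_ge0.
  by rewrite natrM exprMn -pq exprD le_eqVlt; apply/orP; left; apply/eqP; ring.
apply: (@le_trans _ _ (\sum_(n < T * N) n%:R ^+ p * w n * rho ^+ n)).
  rewrite (big_ord_widen (T * N) (fun n => n%:R ^+ p * w n * rho ^+ n)); last by rewrite leq_pmulr.
  rewrite big_mkcond; apply: ler_sum => i _; case: ifP => // _.
  by rewrite !mulr_ge0 ?exprn_ge0.
apply: le_trans (step T) _.
rewrite mulrC -mulrA ler_wpM2r ?mulr_ge0 ?exprn_ge0 //.
apply: le_trans (geo T) _; rewrite mulrC; apply: ler_wpM2r; first exact: ltW.
by rewrite gerBl mulr_ge0 ?exprn_ge0 ?divr_ge0.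
Qed.

(** * Counting functions and n-th elements *)

Lemma count_uptoE (A : set nat) n : count_upto A n = (\sum_(i < n.+1) ((i : nat) \in A))%N.
Proof.
rewrite /count_upto -sum1_card big_mkcond; apply: eq_bigr => i _.
by rewrite inE; case: ifP.
Qed.

Lemma count_upto0 (A : set nat) : count_upto A 0 = (0%N \in A).
Proof. by rewrite count_uptoE big_ord1. Qed.

Lemma count_uptoS (A : set nat) n : count_upto A n.+1 = (count_upto A n + (n.+1 \in A))%N.
Proof. by rewrite !count_uptoE big_ord_recr. Qed.

Lemma count_upto_mono (A : set nat) m n : (m <= n)%N -> (count_upto A m <= count_upto A n)%N.
Proof.
move=> /subnK <-; elim: (n - m)%N => // d IH.
by rewrite addSn count_uptoS (leq_trans IH) // leq_addr.
Qed.

(** The counting function and the enumeration of an infinite set are adjoint.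
    Infinitude is needed for [nth_elt] not to fall back on its default value. *)
Lemma nth_elt_le (A : set nat) i n : (forall k, exists m, (k <= count_upto A m)%N) ->
  (0 < i)%N -> (nth_elt A i <= n)%N = (i <= count_upto A n)%N.
Proof.
move=> unb i0; have [m0 im Hmin] := ex_minnP (unb i).
have [Ax Cx] : A (nth_elt A i) /\ count_upto A (nth_elt A i) = i.
  rewrite /nth_elt; case: xgetP => [y -> //|/(_ m0) []].
  case: m0 im Hmin => [|m] im Hmin.
    rewrite count_upto0 in im *.
    case E: (0%N \in A) im => /= im.
      by split; [exact/set_mem|rewrite count_upto0 E; move: im i0; case: (i) => [|[]]].
    by have := leq_trans i0 im.
  have lt : (count_upto A m < i)%N.
    by rewrite ltnNge; apply/negP => /Hmin; rewrite ltnn.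
  rewrite count_uptoS in im *; case E: (m.+1 \in A) im => /= im.
    by split; [exact/set_mem|rewrite count_uptoS E; lia].
  by lia.
apply/idP/idP => [/(count_upto_mono A)|in_]; first by rewrite Cx.
rewrite leqNgt; apply/negP => lt; move: Cx lt Ax in_.
case: (nth_elt A i) => // x; rewrite count_uptoS ltnS => Cx nx Ax.
have := count_upto_mono A nx; move: Cx; rewrite mem_set //=; lia.
Qed.

Lemma sum_indicator_diff (R : realType) (a b X : nat) :
  \sum_(n < X) `|(a <= n)%:R - (b <= n)%:R| <= `|a%:R - b%:R| :> R.
Proof.
wlog ab : a b / (a <= b)%N => [H|].
  case/orP: (leq_total a b) => [|ba]; first exact: H.
  under eq_bigr => n _ do rewrite distrC.
  by rewrite distrC; exact: H.
rewrite distrC -natrB // ger0_norm //.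
have E n : `|(a <= n)%N%:R - (b <= n)%N%:R| = (a <= n < b)%N%:R :> R.
  case: (leqP a n) => an; case: (leqP b n) => bn //=.
  - by rewrite subrr normr0.
  - by rewrite subr0 normr1.
  - by lia.
  - by rewrite subrr normr0.
under eq_bigr => n _ do rewrite E.
rewrite -natr_sum ler_nat -[X]subn0 -(big_mkord xpredT (fun n => (a <= n < b)%N : nat)).
elim: X => [|X IH]; first by rewrite big_geq.
suff : forall X, (\sum_(0 <= i < X) (a <= i < b) <= minn X b - a)%N.
  by move=> /(_ X.+1); rewrite subn0; lia.
elim=> [|Y IHY]; first by rewrite big_geq.
rewrite big_nat_recr //=; lia.
Qed.

(** Both sides measure the area between the two counting functions: at height
    [n] the difference of the counts is the number of indices [i] such that
    exactly one of the two [i]-th elements is at most [n]. *)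
Lemma sum_count_diff (R : realType) (A B : set nat) (I X : nat) :
  (forall k, exists m, (k <= count_upto A m)%N) ->
  (forall k, exists m, (k <= count_upto B m)%N) ->
  (count_upto A X <= I)%N -> (count_upto B X <= I)%N ->
  \sum_(n < X.+1) `|(count_upto A n)%:R - (count_upto B n)%:R : R| <=
  \sum_(i < I) `|(nth_elt A i.+1)%:R - (nth_elt B i.+1)%:R|.
Proof.
move=> uA uB AI BI.
have cE (D : set nat) n : (forall k, exists m, (k <= count_upto D m)%N) ->
    (count_upto D X <= I)%N -> (n <= X)%N ->
    (count_upto D n)%:R = \sum_(i < I) (nth_elt D i.+1 <= n)%N%:R :> R.
  move=> uD DI nX; rewrite -natr_sum; congr _%:R.
  have DnI := leq_trans (count_upto_mono D nX) DI.
  under eq_bigr => i _ do rewrite nth_elt_le //.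
  move: DnI; move: (count_upto D n) => m mI.
  rewrite -[LHS](card_ord m) -sum1_card (big_ord_widen I (fun=> 1%N)) // big_mkcond.
  by apply: eq_bigr => i _; case: ifP.
under eq_bigr => n _ do rewrite !cE // -1?ltnS // -sumrB.
apply: (@le_trans _ _ (\sum_(n < X.+1) \sum_(i < I)
   `|(nth_elt A i.+1 <= n)%N%:R - (nth_elt B i.+1 <= n)%N%:R|)).
  by apply: ler_sum => n _; exact: ler_norm_sum.
by rewrite exchange_big /=; apply: ler_sum => i _; exact: sum_indicator_diff.
Qed.

(** * Generating polynomials *)

Definition psum (R : realType) (p : {poly R}) (n : nat) : R := \sum_(i < n.+1) p`_i.

Lemma psumM (R : realType) (p q : {poly R}) n :
  psum (p * q) n = \sum_(j < n.+1) p`_j * psum q (n - j).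
Proof.
elim: n => [|n IH]; first by rewrite /psum !big_ord1 coefM big_ord1.
rewrite /psum big_ord_recr /= -/(psum (p * q) n) IH coefM.
rewrite !(big_ord_recr n.+1) /= subnn /psum big_ord1 addrA; congr (_ + _).
rewrite -big_split /=; apply: eq_bigr => j _.
by rewrite subSn -1?ltnS // [in RHS]big_ord_recr mulrDr.
Qed.

Lemma psum_mono (R : realType) (p : {poly R}) m n :
  (forall i, 0 <= p`_i) -> (m <= n)%N -> psum p m <= psum p n.
Proof.
move=> p0 mn; rewrite /psum (big_ord_widen n.+1 (fun i => p`_i)) //.
by rewrite big_mkcond; apply: ler_sum => i _; case: ifP.
Qed.

Lemma psum_ge0 (R : realType) (p : {poly R}) n : (forall i, 0 <= p`_i) -> 0 <= psum p n.
Proof. by move=> p0; apply: sumr_ge0. Qed.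

Lemma psumM_le (R : realType) (p q : {poly R}) n :
  (forall i, 0 <= p`_i) -> (forall i, 0 <= q`_i) ->
  psum (p * q) n <= psum p n * psum q n.
Proof.
move=> p0 q0; rewrite psumM mulr_suml; apply: ler_sum => j _.
by rewrite ler_wpM2l // psum_mono // leq_subr.
Qed.

(** Exponents bounded by [n] and by [m] have a sum bounded by [n + m]. *)
Lemma psumM_ge (R : realType) (p q : {poly R}) n m :
  (forall i, 0 <= p`_i) -> (forall i, 0 <= q`_i) ->
  psum p n * psum q m <= psum (p * q) (n + m).
Proof.
move=> p0 q0; rewrite psumM mulr_suml.
have le : (n.+1 <= (n + m).+1)%N by rewrite ltnS leq_addr.
rewrite (big_ord_widen _ (fun j => p`_j * psum q m) le) big_mkcond.
apply: ler_sum => j _; case: ifP => jn; last by rewrite mulr_ge0 ?psum_ge0.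
by rewrite ler_wpM2l // psum_mono //; lia.
Qed.

Lemma coefM_le (R : realType) (p q p' q' : {poly R}) n :
  (forall i, 0 <= p`_i) -> (forall i, 0 <= q`_i) ->
  (forall i, (i <= n)%N -> p`_i <= p'`_i) -> (forall i, (i <= n)%N -> q`_i <= q'`_i) ->
  forall i, (i <= n)%N -> (p * q)`_i <= (p' * q')`_i.
Proof.
move=> p0 q0 pp qq i ni; rewrite !coefM; apply: ler_sum => j _.
by apply: ler_pM => //; [apply: pp|apply: qq]; have := ltn_ord j; lia.
Qed.

Definition gen_poly (R : realType) (A : set nat) (T : nat) : {poly R} :=
  \poly_(a < T.+1) (a \in A)%:R.

Lemma coef_gen_poly (R : realType) (A : set nat) T i :
  (gen_poly R A T)`_i = ((i <= T)%N && (i \in A))%:R.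
Proof. by rewrite coef_poly ltnS; case: leqP. Qed.

Lemma gen_poly_ge0 (R : realType) (A : set nat) T i : 0 <= (gen_poly R A T)`_i.
Proof. by rewrite coef_gen_poly. Qed.

Lemma size_gen_poly (R : realType) (A : set nat) T : (size (gen_poly R A T) <= T.+1)%N.
Proof. exact: size_poly. Qed.

Lemma psum_gen_poly (R : realType) (A : set nat) T n :
  psum (gen_poly R A T) n = (count_upto A (minn n T))%:R.
Proof.
rewrite count_uptoE natr_sum.
have le : ((minn n T).+1 <= n.+1)%N by rewrite ltnS geq_minl.
rewrite (big_ord_widen _ (fun i => (i \in A)%:R) le) [RHS]big_mkcond.
apply: eq_bigr => i _; rewrite coef_gen_poly ltnS leq_min -(ltnS i n) ltn_ord /=.
by case: leqP.
Qed.

Definition gen_prod (R : realType) (k : nat) (A : 'I_k -> set nat) (T : nat) : {poly R} :=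
  \prod_(i < k) gen_poly R (A i) T.

Lemma gen_prod_ge0 (R : realType) k (A : 'I_k -> set nat) T i : 0 <= (gen_prod R A T)`_i.
Proof.
rewrite /gen_prod; move: i; elim/big_ind: _ => [i|p q p0 q0 i|j _ i].
- by rewrite coef1.
- exact: coefM_ge0.
- exact: gen_poly_ge0.
Qed.

(** A coefficient of degree at most [n] of the product only depends on the
    elements that are at most [n]. *)
Lemma gen_prod_le (R : realType) k (A : 'I_k -> set nat) (n S T : nat) :
  (minn n S <= T)%N -> forall i, (i <= n)%N -> (gen_prod R A S)`_i <= (gen_prod R A T)`_i.
Proof.
move=> ST.
suff : (forall i, 0 <= (gen_prod R A S)`_i) /\
  (forall i, (i <= n)%N -> (gen_prod R A S)`_i <= (gen_prod R A T)`_i) by case.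
rewrite /gen_prod; elim/big_rec2: _ => [|j p q _ [q0 qp]].
  by split => i; rewrite ?coef1.
split=> [i|]; first by apply: coefM_ge0 => // l; exact: gen_poly_ge0.
apply: coefM_le => // [i|i ni]; rewrite ?gen_poly_ge0 // !coef_gen_poly ler_nat.
case: (leqP i S) => //= iS; rewrite (_ : (i <= T)%N) //.
by apply: leq_trans ST; rewrite leq_min ni.
Qed.

(** Distributing the product over the sums makes the tuples counted by
    [rep_count] appear as the choice functions. *)
Lemma psum_gen_prod_diag (R : realType) k (A : 'I_k -> set nat) n :
  psum (gen_prod R A n) n = (rep_count A n)%:R.
Proof.
have E : gen_prod R A n = \sum_(f : {ffun 'I_k -> 'I_n.+1})
   [forall i, (f i : nat) \in A i]%:R *: 'X^(\sum_i (f i : nat)).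
  rewrite /gen_prod (eq_bigr (fun i => \sum_(a < n.+1) ((a : nat) \in A i)%:R *: 'X^a)) => [|i _].
    rewrite bigA_distr_bigA /=; apply: eq_bigr => f _.
    rewrite (eq_bigr (fun i => (((f i : nat) \in A i)%:R)%:P * 'X^(f i))) => [|i _].
      rewrite big_split /= -mul_polyC; congr (_ * _).
        rewrite -rmorph_prod; congr _%:P => /=.
        case: forallP => [H|H].
          by rewrite big1 // => i _; rewrite H.
        have [i /negbTE iA] : exists i, ~~ ((f i : nat) \in A i).
          by apply/existsP; rewrite -negb_forall; apply/forallP.
        by rewrite (bigD1 i) //= iA mul0r.
      by rewrite prodrXr.
    by rewrite mul_polyC.
  by rewrite /gen_poly poly_def.
rewrite /psum E /rep_count -sum1_card natr_sum.
rewrite (eq_bigr (fun m : 'I_n.+1 => \sum_(f : {ffun 'I_k -> 'I_n.+1})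
   ([forall i, (f i : nat) \in A i]%:R *: 'X^(\sum_i (f i : nat)) : {poly R})`_m)) => [|m _];
  last by rewrite coef_sum.
rewrite exchange_big /= [RHS]big_mkcond; apply: eq_bigr => f _.
under eq_bigr => m _ do rewrite coefZ coefXn.
rewrite -mulr_sumr inE; case: forallP => H /=; last by rewrite mul0r.
rewrite mul1r; case: leqP => [le|lt].
  rewrite (bigD1 (Ordinal (le : (\sum_i (f i : nat) < n.+1)%N))) //= eqxx big1 ?addr0 // => m mn.
  by case: eqP => // mE; case/eqP: mn; apply: val_inj.
by rewrite big1 // => m _; case: eqP => // mE; have := ltn_ord m; lia.
Qed.

Lemma psum_gen_prod (R : realType) k (A : 'I_k -> set nat) n T : (n <= T)%N ->
  psum (gen_prod R A T) n = (rep_count A n)%:R.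
Proof.
move=> nT; rewrite -psum_gen_prod_diag; apply: eq_bigr => i _.
by apply/eqP; rewrite eq_le !(@gen_prod_le R k A n) // -1?ltnS //; lia.
Qed.

Lemma psum_gen_prod_le (R : realType) k (A : 'I_k -> set nat) n T :
  psum (gen_prod R A T) n <= (rep_count A n)%:R.
Proof.
rewrite -psum_gen_prod_diag; apply: ler_sum => i _.
by rewrite (@gen_prod_le R k A n) // -1?ltnS //; lia.
Qed.

Lemma gen_prod_recl (R : realType) k (A : 'I_k.+1 -> set nat) T :
  gen_prod R A T = gen_poly R (A ord0) T * gen_prod R (fun i => A (lift ord0 i)) T.
Proof. by rewrite /gen_prod big_ord_recl. Qed.

Lemma size_gen_prod (R : realType) k (A : 'I_k -> set nat) T :
  (size (gen_prod R A T) <= (k * T).+1)%N.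
Proof.
elim: k A => [|k IH] A; first by rewrite /gen_prod big_ord0 size_poly1.
rewrite gen_prod_recl (leq_trans (size_polyMleq _ _)) //.
have := size_gen_poly R (A ord0) T; have := IH (fun i => A (lift ord0 i)).
by rewrite mulSn; move: (size _) (size _) => x y; lia.
Qed.

Lemma wnorm1_horner (R : realType) (r : R) (p : {poly R}) : (forall i, 0 <= p`_i) ->
  wnorm1 r p = p.[r].
Proof.
by move=> p0; rewrite /wnorm1 horner_coef; apply: eq_bigr => i _; rewrite ger0_norm.
Qed.

Lemma horner1_gen_prod (R : realType) k (A : 'I_k -> set nat) T :
  0 <= (gen_prod R A T).[1] <= T.+1%:R ^+ k.
Proof.
rewrite /gen_prod horner_prod -[k in _ ^+ k]card_ord -prodr_const.
have H i : 0 <= (gen_poly R (A i) T).[1] <= T.+1%:R.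
  rewrite (horner_coef_wide _ (size_gen_poly R (A i) T)).
  apply/andP; split; first by apply: sumr_ge0 => j _; rewrite expr1n mulr1 gen_poly_ge0.
  have -> : T.+1%:R = \sum_(j < T.+1) 1 :> R by rewrite sumr_const card_ord.
  apply: ler_sum => j _.
  by rewrite expr1n mulr1 coef_gen_poly lern1; case: (_ && _).
apply/andP; split; first by apply: prodr_ge0 => i _; case/andP: (H i).
exact: ler_prod.
Qed.

(** * The diagonal contribution *)

Lemma sum_window (R : realType) (x l n : nat) : (x + l <= n)%N ->
  \sum_(i < n) (x <= i < x + l)%N%:R = l%:R :> R.
Proof.
move=> xln; rewrite -natr_sum; congr _%:R.
rewrite -(big_mkord xpredT (fun i => (x <= i < x + l)%N : nat)).
suff : forall Y, (\sum_(0 <= i < Y) (x <= i < x + l) = minn Y (x + l) - x)%N.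
  by move=> ->; lia.
elim=> [|Y IHY]; first by rewrite big_geq //; lia.
rewrite big_nat_recr //= IHY; lia.
Qed.

Lemma sum_count_between (R : realType) (A : set nat) (N1 N2 : nat) : (N1 <= N2)%N ->
  \sum_(a < N2.+1) ((N1 < a)%N && ((a : nat) \in A))%:R =
  (count_upto A N2)%:R - (count_upto A N1)%:R :> R.
Proof.
move=> N12; rewrite !count_uptoE !natr_sum.
have le : (N1.+1 <= N2.+1)%N by rewrite ltnS.
rewrite (big_ord_widen _ (fun a => (a \in A)%:R) le) [X in _ = _ - X]big_mkcond -sumrB.
apply: eq_bigr => a _; rewrite ltnS; case: leqP => /=; first by rewrite subrr.
by rewrite subr0.
Qed.

(** Expanding both factors [s] over the elements of [A], only the pairs of equal
    elements [a] are kept, with [N1 < a <= N2], and only the coefficients of [H]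
    of degree [d <= l]. Two windows of length [2 * l] that end at distance [d]
    share at least [l] positions, which gives [l] indices [i] for each [a] and
    [d]; the factor [N1] comes from [theta]. *)
Lemma diagonal_lower_bound (R : realType) (r : R) (A : set nat) (S H : {poly R})
    (N1 N2 l T n : nat) :
  0 <= r <= 1 -> (forall i, (gen_poly R A T)`_i <= S`_i) -> (forall i, 0 <= H`_i) ->
  (N1 <= N2 <= T)%N -> (N2 + 2 * l <= n)%N ->
  forall s, s = S * window R (2 * l) ->
  ((count_upto A N2)%:R - (count_upto A N1)%:R) * psum H l
     * (l%:R * (N1%:R * r ^+ (2 * (N2 + 2 * l))))
  <= \sum_(i < n) s`_i * (theta s * H)`_i * r ^+ (2 * i).
Proof.
move=> /andP[r0 r1] AS H0 /andP[N12 N2T] N2n s sE.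
have S0 i : 0 <= S`_i by apply: le_trans (AS i); exact: gen_poly_ge0.
have win0 i : 0 <= (window R (2 * l))`_i by rewrite coef_poly; case: ifP.
have s0 i : 0 <= s`_i by rewrite sE; exact: coefM_ge0.
(* [u a i] is the contribution of the element [a] to the coefficient [s`_i]. *)
pose u a i : R := ((a \in A) && (a <= i < a + 2 * l)%N)%:R.
have sf i : \sum_(a < N2.+1) u a i <= s`_i.
  rewrite sE coefM.
  have le1 : (N2.+1 <= (N2 + i).+1)%N by lia.
  have le2 : (i.+1 <= (N2 + i).+1)%N by lia.
  rewrite (big_ord_widen _ (fun a => u a i) le1) big_mkcond.
  rewrite (big_ord_widen _ (fun a => S`_a * (window R (2 * l))`_(i - a)) le2) [leRHS]big_mkcond.
  apply: ler_sum => a _.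
  case: (ltnP a N2.+1) => aN; last by case: ifP => // _; rewrite mulr_ge0.
  case: (ltnP a i.+1) => ai; last by rewrite /u [(a <= i)%N]leqNgt ai andbF.
  rewrite coef_poly; case: ltnP => iM; last first.
    by rewrite mulr0 /u (_ : (a <= i < a + 2 * l)%N = false) ?andbF //; lia.
  rewrite mulr1; apply: le_trans (AS a); rewrite coef_gen_poly (_ : (a <= T)%N) /=; last by lia.
  by rewrite /u ler_nat; case: (_ \in A) => //=; exact: leq_b1.
pose W := N1%:R * r ^+ (2 * (N2 + 2 * l)) : R.
have W0 : 0 <= W by rewrite mulr_ge0 ?exprn_ge0.
pose cnt : R := (count_upto A N2)%:R - (count_upto A N1)%:R.
have key d : (d <= l)%N ->
    cnt * (l%:R * W) <= \sum_(i < n)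
      (if (d <= i)%N then s`_i * (s`_(i - d) *+ (i - d)) else 0) * r ^+ (2 * i).
  move=> dl.
  have -> : cnt * (l%:R * W) = \sum_(i < n) \sum_(a < N2.+1)
      ((N1 < a)%N && ((a : nat) \in A))%:R * (a + d <= i < a + d + l)%N%:R * W.
    rewrite exchange_big /= /cnt -(sum_count_between R A N12) mulr_suml.
    apply: eq_bigr => a _; rewrite -mulr_suml -mulr_sumr sum_window ?mulrA //.
    by have := ltn_ord a; lia.
  apply: ler_sum => i _; case: (leqP d i) => di; last first.
    rewrite mul0r big1 // => a _.
    by rewrite (_ : (a + d <= i < a + d + l)%N = false) ?mulr0 ?mul0r //; lia.
  have ss : \sum_(a < N2.+1) u a i * u a (i - d)%N <= s`_i * s`_(i - d).
    apply: (@le_trans _ _ ((\sum_(a < N2.+1) u a i) * (\sum_(b < N2.+1) u b (i - d)%N))).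
      rewrite mulr_suml; apply: ler_sum => a _; rewrite ler_wpM2l //.
      by rewrite (bigD1 a) //= lerDl sumr_ge0.
    by apply: ler_pM => //; exact: sumr_ge0.
  apply: (@le_trans _ _ (\sum_(a < N2.+1) u a i * u a (i - d)%N *+ (i - d) * r ^+ (2 * i))).
    apply: ler_sum => a _; rewrite /u.
    case: (N1 < a)%N/ltnP => N1a /=; last first.
      by rewrite !mul0r mulr_ge0 ?exprn_ge0 // mulrn_wge0 // mulr_ge0.
    case: (_ \in A) => /=; last by rewrite !mul0r mul0rn mul0r.
    case: (boolP (a + d <= i < a + d + l)%N) => ai; last first.
      by rewrite mulr0 mul0r mulr_ge0 ?exprn_ge0 // mulrn_wge0 // mulr_ge0.
    rewrite (_ : (a <= i < a + 2 * l)%N); last by lia.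
    rewrite (_ : (a <= i - d < a + 2 * l)%N); last by lia.
    rewrite !mul1r /W; apply: ler_pM; rewrite ?exprn_ge0 //.
      by rewrite ler_nat; lia.
    by rewrite ler_wiXn2l //; have := ltn_ord a; lia.
  rewrite -mulr_suml sumrMnl ler_wpM2r ?exprn_ge0 //.
  by rewrite mulrnAr lerMn2r ss orbT.
rewrite mulrAC mulrC -/W -/cnt {1}/psum mulr_suml.
apply: (@le_trans _ _ (\sum_(d < l.+1) H`_d *
   (\sum_(i < n) (if (d <= i)%N then s`_i * (s`_(i - d) *+ (i - d)) else 0) * r ^+ (2 * i)))).
  by apply: ler_sum => d _; rewrite ler_wpM2l // key // -ltnS.
under eq_bigr => d _ do rewrite mulr_sumr.
rewrite exchange_big /=; apply: ler_sum => i _.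
rewrite (eq_bigr (fun d : 'I_l.+1 =>
  (if (d <= i)%N then s`_i * (H`_d * (theta s)`_(i - d)) else 0) * r ^+ (2 * i)))
  => [|d _]; last first.
  by case: ifP => _; rewrite ?mul0r ?mulr0 // coef_theta; ring.
rewrite -mulr_suml ler_wpM2r ?exprn_ge0 //.
rewrite [theta s * H]mulrC coefM mulr_sumr.
have le1 : (l.+1 <= (l + i).+1)%N by lia.
have le2 : (i.+1 <= (l + i).+1)%N by lia.
have ts0 j : 0 <= (theta s)`_j by rewrite coef_theta mulrn_wge0.
rewrite (big_ord_widen _ (fun d => if (d <= i)%N then s`_i * (H`_d * (theta s)`_(i - d)) else 0) le1) big_mkcond.
rewrite (big_ord_widen _ (fun d => s`_i * (H`_d * (theta s)`_(i - d))) le2) [leRHS]big_mkcond.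
apply: ler_sum => d _; rewrite !ltnS.
have ge0 : 0 <= s`_i * (H`_d * (theta s)`_(i - d)) by rewrite !mulr_ge0.
by case: ifP => _; case: ifP.
Qed.

(** * Window sums *)

Lemma coefM_window (R : realType) (p : {poly R}) M i :
  (p * window R M)`_i = psum p i - (if (M <= i)%N then psum p (i - M) else 0).
Proof.
rewrite coefM /psum.
have -> : (if (M <= i)%N then \sum_(j < (i - M).+1) p`_j else 0) =
    \sum_(j < i.+1) (if (j + M <= i)%N then p`_j else 0).
  case: leqP => Mi; last by rewrite big1 // => j _; rewrite ifF //; lia.
  have le : ((i - M).+1 <= i.+1)%N by lia.
  rewrite (big_ord_widen _ (fun j => p`_j) le) big_mkcond.
  by apply: eq_bigr => j _; congr (if _ then _ else _); lia.
rewrite -sumrB; apply: eq_bigr => j _; rewrite coef_poly.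
have := ltn_ord j; case: ifP => a; case: ifP => b ji; rewrite ?mulr1 ?mulr0 ?subr0 ?subrr //; lia.
Qed.

(** * Truncation errors *)

(** Turns [wnorm1] into an evaluation, which is multiplicative. *)
Definition abs_poly (R : realType) (p : {poly R}) : {poly R} := \poly_(i < size p) `|p`_i|.

Lemma coef_abs_poly (R : realType) (p : {poly R}) i : (abs_poly p)`_i = `|p`_i|.
Proof. by rewrite coef_poly; case: ltnP => // pi; rewrite nth_default ?normr0. Qed.

Lemma wnorm1_abs_poly (R : realType) (r : R) (p : {poly R}) : wnorm1 r p = (abs_poly p).[r].
Proof.
rewrite (horner_coef_wide _ (size_poly _ _)); apply: eq_bigr => i _.
by rewrite coef_abs_poly.
Qed.

Lemma wnorm1M (R : realType) (r : R) (p q : {poly R}) : 0 <= r ->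
  wnorm1 r (p * q) <= wnorm1 r p * wnorm1 r q.
Proof.
move=> r0; rewrite !wnorm1_abs_poly -hornerM.
have sz : (size (abs_poly p * abs_poly q)%R <= size p + size q)%N.
  apply: leq_trans (size_polyMleq _ _) _.
  have h1 : (size (abs_poly p) <= size p)%N by exact: size_poly.
  have h2 : (size (abs_poly q) <= size q)%N by exact: size_poly.
  by rewrite (leq_trans (leq_pred _)) // leq_add.
have sz' : (size (abs_poly (p * q)%R) <= size p + size q)%N.
  apply: leq_trans (size_poly _ _) _.
  by apply: leq_trans (size_polyMleq _ _) _; exact: leq_pred.
rewrite (horner_coef_wide _ sz) (horner_coef_wide _ sz'); apply: ler_sum => i _.
rewrite ler_wpM2r ?exprn_ge0 // coef_abs_poly !coefM.
apply: le_trans (ler_norm_sum _ _ _) _; apply: ler_sum => j _.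
by rewrite normrM !coef_abs_poly.
Qed.

Lemma wnorm1D (R : realType) (r : R) (p q : {poly R}) : 0 <= r ->
  wnorm1 r (p + q) <= wnorm1 r p + wnorm1 r q.
Proof.
move=> r0.
rewrite (@wnorm1E R r p (maxn (size p) (size q))) ?leq_maxl //.
rewrite (@wnorm1E R r q (maxn (size p) (size q))) ?leq_maxr //.
rewrite (@wnorm1E R r (p + q) (maxn (size p) (size q))) ?size_polyD //.
rewrite -big_split /=; apply: ler_sum => i _.
by rewrite -mulrDl ler_wpM2r ?exprn_ge0 // coefD ler_normD.
Qed.

Lemma wnorm1N (R : realType) (r : R) (p : {poly R}) : wnorm1 r (- p) = wnorm1 r p.
Proof. by rewrite /wnorm1 size_polyN; apply: eq_bigr => i _; rewrite coefN normrN. Qed.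

Definition vanish_upto (R : realType) (T : nat) (p : {poly R}) := forall i, (i <= T)%N -> p`_i = 0.

Lemma vanish_uptoM (R : realType) T (p q : {poly R}) : vanish_upto T p -> vanish_upto T (p * q).
Proof.
move=> p0 i iT; rewrite coefM big1 // => j _; rewrite p0 ?mul0r //.
by apply: leq_trans iT; rewrite -ltnS.
Qed.

Lemma vanish_upto_theta (R : realType) T (p : {poly R}) : vanish_upto T p -> vanish_upto T (theta p).
Proof. by move=> p0 i iT; rewrite coef_theta p0 // mul0rn. Qed.

(** The gain [r ^+ T] is what makes truncation harmless. *)
Lemma wnorm1_vanish_upto (R : realType) (r : R) T (p : {poly R}) : 0 <= r <= 1 ->
  vanish_upto T p -> wnorm1 r p <= r ^+ T * wnorm1 1 p.
Proof.
move=> /andP[r0 r1] p0; rewrite /wnorm1 mulr_sumr; apply: ler_sum => i _.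
rewrite expr1n mulr1; case: (leqP i T) => iT; first by rewrite p0 // normr0 mul0r mulr0.
by rewrite mulrC ler_wpM2r // ler_wiXn2l // ltnW.
Qed.

(** The truncation of [X / (1 - X)]: its coefficient of degree 0 vanishes, in
    agreement with the value of [c * n] at [n = 0]. *)
Definition ones_poly (R : realType) (T : nat) : {poly R} := \poly_(n < T.+1) (n != 0%N)%:R.

Definition error_poly (R : realType) (rk : nat -> nat) (c : R) (T : nat) : {poly R} :=
  \poly_(n < T.+1) ((rk n)%:R - c * n%:R).

(** Up to degree [T], both polynomials have the coefficients of [X / (1 - X)^2]. *)
Lemma vanish_upto_main (R : realType) T :
  vanish_upto T ('X * window R T.+1 ^+ 2 - theta (ones_poly R T)).
Proof.
move=> i iT; rewrite coefB coefXM coef_theta coef_poly ltnS iT.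
case: i iT => [|i] iT; first by rewrite mulr0n subrr.
rewrite /= expr2 coefM (eq_bigr (fun=> 1)) => [|j _].
  by rewrite sumr_const card_ord subrr.
have ji := ltn_ord j; rewrite !coef_poly !ifT ?mulr1 //; lia.
Qed.

Lemma wnorm1_main (R : realType) T :
  wnorm1 1 ('X * window R T.+1 ^+ 2 - theta (ones_poly R T)) <= 2 * T.+1%:R ^+ 2.
Proof.
have w : wnorm1 1 (window R T.+1) <= T.+1%:R by apply: wnorm1_window; rewrite ler01 lexx.
apply: le_trans (wnorm1D _ _ ler01) _; rewrite wnorm1N mulr2n mulrDl mul1r; apply: lerD.
  apply: le_trans (wnorm1M _ _ ler01) _; rewrite -['X]expr1 wnorm1Xn expr1n mul1r.
  apply: le_trans (wnorm1M _ _ ler01) _; rewrite expr2.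
  by apply: ler_pM => //; exact: wnorm1_ge0.
apply: le_trans (wnorm1_theta ler01 (size_poly _ _)) _; rewrite expr2 ler_wpM2l //.
rewrite (wnorm1E 1 (size_poly _ _)).
have -> : T.+1%:R = \sum_(j < T.+1) 1 :> R by rewrite sumr_const card_ord.
apply: ler_sum => i _; rewrite expr1n mulr1 coef_poly ltn_ord ger0_norm //.
by rewrite lern1 leq_b1.
Qed.

Lemma rep_count_ub (k : nat) (A : 'I_k -> set nat) n : (rep_count A n <= n.+1 ^ k)%N.
Proof. by rewrite /rep_count (leq_trans (max_card _)) // card_ffun !card_ord. Qed.

(** What truncation at degree [T] leaves over in the identity
    [P = c X / (1 - X) + (1 - X) V]. *)
Definition tail_poly (R : realType) k (A : 'I_k -> set nat) (c : R) T : {poly R} :=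
  gen_prod R A T - c%:P * ones_poly R T - (1 - 'X) * error_poly (rep_count A) c T.

(** In degree [i > 0] the coefficient of the product is [R i - R (i - 1)], and
    [R i = c i + v i] where [v] is the sequence of coefficients of [error_poly]. *)
Lemma vanish_upto_tail (R : realType) k (A : 'I_k -> set nat) (c : R) T :
  vanish_upto T (tail_poly A c T).
Proof.
move=> i iT; rewrite /tail_poly mulrBl mul1r !(coefB, coefCM, coefXM, coef_poly).
rewrite !ltnS iT; case: i iT => [|i] iT /=.
  have := psum_gen_prod R A (leq0n T); rewrite /psum big_ord1 /= => ->.
  by rewrite !mulr0 !subr0 subrr.
have := psum_gen_prod R A iT; rewrite /psum big_ord_recr /= => H.
have := psum_gen_prod R A (ltnW iT); rewrite /psum => H'.
rewrite H' in H; rewrite (ltnW iT) mulr1 -natr1; lra.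
Qed.

(** A crude bound: any power of [T] is absorbed by [r ^+ T]. *)
Lemma wnorm1_tail (R : realType) k (A : 'I_k -> set nat) (c : R) T : 0 <= c ->
  wnorm1 1 (tail_poly A c T) <= (3 + 3 * c) * T.+1%:R ^+ k.+2.
Proof.
move=> c0; rewrite /tail_poly.
have T1 : 1 <= T.+1%:R :> R by rewrite ler1n.
have T0 : 0 <= T.+1%:R :> R by [].
set t : R := T.+1%:R in T1 T0 *.
have le1 j : (j <= k.+2)%N -> t ^+ j <= t ^+ k.+2 by move=> jk; exact: ler_weXn2l.
have bP : wnorm1 1 (gen_prod R A T) <= t ^+ k.+2.
  rewrite wnorm1_horner; last exact: gen_prod_ge0.
  by case/andP: (horner1_gen_prod R A T) => _ /le_trans; apply; apply: le1; lia.
have bJ : wnorm1 1 (ones_poly R T) <= t ^+ k.+2.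
  apply: (@le_trans _ _ t); last by rewrite -[leLHS]expr1 le1.
  rewrite (wnorm1E 1 (size_poly _ _)) /t.
  have -> : T.+1%:R = \sum_(j < T.+1) 1 :> R by rewrite sumr_const card_ord.
  apply: ler_sum => i _; rewrite expr1n mulr1 coef_poly ltn_ord ger0_norm //.
  by rewrite lern1 leq_b1.
have bV : wnorm1 1 (error_poly (rep_count A) c T) <= t ^+ k.+2 + c * t ^+ k.+2.
  rewrite (wnorm1E 1 (size_poly _ _)).
  apply: (@le_trans _ _ (\sum_(i < T.+1) (t ^+ k.+1 + c * t ^+ k.+1))).
    apply: ler_sum => i _; rewrite expr1n mulr1 coef_poly ltn_ord.
    apply: le_trans (ler_normB _ _) _; rewrite !ger0_norm ?mulr_ge0 //; apply: lerD.
      apply: (@le_trans _ _ (t ^+ k)); last exact: ler_weXn2l.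
      rewrite /t -natrX ler_nat (leq_trans (rep_count_ub A i)) //.
      by have := ltn_ord i; case: (k) => // k'; rewrite leq_exp2r.
    rewrite ler_wpM2l //; apply: (@le_trans _ _ t).
      by rewrite ler_nat ltnW // ltnS ltnW.
    by rewrite -[leLHS]expr1 ler_weXn2l.
  by rewrite sumr_const card_ord -mulr_natl -/t mulrDr (exprS t k.+1) mulrCA.
have n1 : wnorm1 1 (1 - 'X : {poly R}) <= 2.
  apply: le_trans (wnorm1D _ _ ler01) _.
  rewrite wnorm1N -['X]expr1 wnorm1Xn -[1 : {poly R}]/(1%:P) wnorm1C normr1 expr1n.
  by rewrite -[2]/(1 + 1).
apply: le_trans (wnorm1D _ _ ler01) _; rewrite wnorm1N.
have h1 := wnorm1D (gen_prod R A T) (- (c%:P * ones_poly R T)) (@ler01 R).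
rewrite wnorm1N in h1.
have h2 := wnorm1M c%:P (ones_poly R T) (@ler01 R).
rewrite wnorm1C ger0_norm // in h2.
have h3 := wnorm1M (1 - 'X) (error_poly (rep_count A) c T) (@ler01 R).
have h4 : wnorm1 1 (1 - 'X : {poly R}) * wnorm1 1 (error_poly (rep_count A) c T) <=
   2 * (t ^+ k.+2 + c * t ^+ k.+2) by apply: ler_pM => //; exact: wnorm1_ge0.
have h5 : c * wnorm1 1 (ones_poly R T) <= c * t ^+ k.+2 by rewrite ler_wpM2l.
lra.
Qed.

Lemma size_tail (R : realType) k (A : 'I_k -> set nat) (c : R) T :
  (size (tail_poly A c T) <= (k + 2) * T.+1)%N.
Proof.
rewrite /tail_poly; apply: leq_trans (size_polyD _ _) _; rewrite geq_max size_polyN; apply/andP; split.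
  apply: leq_trans (size_polyD _ _) _; rewrite geq_max size_polyN; apply/andP; split.
    by apply: leq_trans (size_gen_prod _ _ _) _; nia.
  rewrite mul_polyC; apply: leq_trans (size_scale_leq _ _) _.
  by apply: leq_trans (size_poly _ _) _; rewrite leq_pmull // addn2.
rewrite mulrBl mul1r (leq_trans (size_polyD _ _)) // geq_max size_polyN.
have sV : (size (error_poly (rep_count A) c T) <= T.+1)%N by exact: size_poly.
have T2 : (T.+2 <= (k + 2) * T.+1)%N by rewrite mulnDl; lia.
apply/andP; split; first by apply: leq_trans sV _; exact: leq_trans (leqnSn _) T2.
have := size_polyMleq 'X (error_poly (rep_count A) c T); rewrite size_polyX => H.
by apply: leq_trans H _; apply: leq_trans T2.
Qed.

Lemma wnorm1_theta_tail (R : realType) k (A : 'I_k -> set nat) (c r : R) M T :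
  0 <= r <= 1 -> 0 <= c ->
  wnorm1 r (theta (tail_poly A c T * window R M ^+ 2)) <=
  (k + 2 + 2 * M)%:R * M%:R ^+ 2 * (3 + 3 * c) * (T.+1%:R ^+ (k + 3) * r ^+ T).
Proof.
move=> r01 c0; have van := vanish_upto_theta (vanish_uptoM (window R M ^+ 2) (@vanish_upto_tail R k A c T)).
apply: le_trans (wnorm1_vanish_upto r01 van) _; rewrite [leRHS]mulrA [leRHS]mulrC.
have r0 : 0 <= r by case/andP: r01.
apply: ler_wpM2l; first exact: exprn_ge0.
have sz : (size (tail_poly A c T * window R M ^+ 2)%R <= (k + 2 + 2 * M) * T.+1)%N.
  rewrite expr2; apply: leq_trans (size_polyMleq _ _) _.
  have h1 := size_tail A c T; have h2 : (size (window R M) <= M)%N by exact: size_poly.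
  have h3 := size_polyMleq (window R M) (window R M).
  have : (size (tail_poly A c T) + size (window R M * window R M)%R <= (k + 2) * T.+1 + 2 * M)%N by lia.
  by move: (size _) (size _) => x y; nia.
apply: le_trans (wnorm1_theta ler01 sz) _.
have w : wnorm1 1 (window R M) <= M%:R by apply: wnorm1_window; rewrite ler01 lexx.
have w2 : wnorm1 1 (window R M ^+ 2) <= M%:R ^+ 2.
  by apply: le_trans (wnorm1M _ _ ler01) _; rewrite expr2; apply: ler_pM => //; exact: wnorm1_ge0.
have h : wnorm1 1 (tail_poly A c T * window R M ^+ 2) <= ((3 + 3 * c) * T.+1%:R ^+ k.+2) * M%:R ^+ 2.
  apply: le_trans (wnorm1M _ _ ler01) _.
  by apply: ler_pM; rewrite ?wnorm1_ge0 //; exact: wnorm1_tail.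
rewrite natrM addn3.
apply: le_trans (ler_wpM2l _ h) _; first by rewrite mulr_ge0.
move: ((k + 2 + 2 * M)%:R : R) (T.+1%:R : R) => x t.
by rewrite (exprS t k.+2) le_eqVlt; apply/orP; left; apply/eqP; ring.
Qed.

(** * Choice of the radius *)

Lemma powR_le2 (R : realType) (s x y : R) : 0 <= s -> 0 <= x -> x <= y ->
  x `^ s <= y `^ s.
Proof.
by move=> s0 x0 xy; apply: ge0_ler_powR; rewrite ?nnegrE // (le_trans x0).
Qed.

Lemma bernoulli_pos (R : realType) (x : R) n : 0 <= x -> 1 + n%:R * x <= (1 + x) ^+ n.
Proof.
move=> x0; elim: n => [|n IH]; first by rewrite mul0r addr0 expr0.
rewrite exprS; apply: le_trans (ler_wpM2l _ IH); last by lra.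
rewrite -natr1; have n0 : 0 <= n%:R :> R by [].
by have := mulr_ge0 n0 (sqr_ge0 x); rewrite expr2; nra.
Qed.

Lemma bernoulli_neg (R : realType) (x : R) n : 0 <= x <= 1 -> 1 - n%:R * x <= (1 - x) ^+ n.
Proof.
move=> /andP[x0 x1]; elim: n => [|n IH]; first by rewrite mul0r subr0 expr0.
rewrite exprS; apply: le_trans (ler_wpM2l _ IH); last by lra.
rewrite -natr1; have n0 : 0 <= n%:R :> R by [].
by have := mulr_ge0 n0 (sqr_ge0 x); rewrite expr2; nra.
Qed.

(** The radius [1 - 1 / (2 N)]. The two bounds on its powers follow from
    Bernoulli's inequality for [1 - x] and for [1 + x], as [(1 - x) (1 + x) <= 1]. *)
Lemma radius_exists (R : realType) (N : nat) : (0 < N)%N ->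
  exists r : R, [/\ 0 <= r < 1, 1 / 2 <= r ^+ N, r ^+ (2 * N) <= 1 / 2 &
    forall n, \sum_(i < n) r ^+ (2 * i) <= 2 * N%:R].
Proof.
move=> N0; have N1 : 1 <= N%:R :> R by rewrite ler1n.
pose y : R := (2 * N%:R)^-1; pose r := 1 - y.
have Np : 0 < 2 * N%:R :> R by lra.
have yN : 2 * N%:R * y = 1 by rewrite /y mulfV // gt_eqF.
have y0 : 0 < y by rewrite invr_gt0.
have y1 : y <= 1 / 2 by nra.
have r0 : 0 <= r by rewrite /r; lra.
exists r; split.
- by rewrite r0 /= /r; lra.
- have h : 1 - N%:R * y <= r ^+ N by apply: bernoulli_neg; apply/andP; split; lra.
  by lra.
- have h1 := bernoulli_pos (2 * N) (ltW y0); rewrite natrM yN in h1.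
  have h2 : r ^+ (2 * N) * (1 + y) ^+ (2 * N) <= 1.
    by rewrite -exprMn; apply: exprn_ile1; rewrite /r; nra.
  have h3 : r ^+ (2 * N) * (1 + 1) <= 1.
    by apply: le_trans h2; apply: ler_wpM2l => //; exact: exprn_ge0.
  by lra.
- move=> n; have h : (1 - r ^+ 2) * \sum_(i < n) r ^+ (2 * i) <= 1.
    under eq_bigr => i _ do rewrite exprM.
    by rewrite -opprB mulNr -subrX1 opprB gerBl !exprn_ge0.
  have S0 : 0 <= \sum_(i < n) r ^+ (2 * i) by apply: sumr_ge0 => i _; exact: exprn_ge0.
  have r2 : y <= 1 - r ^+ 2 by rewrite /r; nra.
  have h4 := le_trans (ler_wpM2r S0 r2) h.
  by rewrite -(ler_pM2l y0) (mulrC y (2 * _)) yN.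
Qed.

(** * The inequality at one scale *)

Lemma powR_unbounded (R : realType) (s Y : R) : 0 < s ->
  exists n0, forall n, (n0 <= n)%N -> Y <= n%:R `^ s.
Proof.
move=> s0; pose y := Num.max Y 0.
have y0 : 0 <= y by rewrite le_max lexx orbT.
exists (Num.bound (y `^ s^-1)) => n nn.
apply: (@le_trans _ _ y); first by rewrite le_max lexx.
have -> : y = (y `^ s^-1) `^ s by rewrite -powRrM mulVf ?gt_eqF // powRr1.
apply: powR_le2; rewrite ?powR_ge0 ?(ltW s0) //.
by apply/ltW; apply: lt_le_trans (archi_boundP (powR_ge0 _ _)) _; rewrite ler_nat.
Qed.

Lemma powR_le_expr (R : realType) (x s : R) n : 1 <= x -> s <= n%:R -> x `^ s <= x ^+ n.
Proof.
move=> x1 sn; rewrite -powR_mulrn ?(le_trans ler01) //.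
exact: ler_powR.
Qed.

(** The coefficients of the difference of two generating functions times a
    window, before truncation. *)
Definition window_diff (R : realType) (A B : set nat) (M i : nat) : R :=
  let d n := (count_upto A n)%:R - (count_upto B n)%:R in
  d i - (if (M <= i)%N then d (i - M)%N else 0).

Lemma coef_window_diff (R : realType) (A B : set nat) (M T i : nat) : (i <= T)%N ->
  ((gen_poly R A T - gen_poly R B T) * window R M)`_i = window_diff R A B M i.
Proof.
move=> iT; rewrite mulrBl coefB !coefM_window !psum_gen_poly /window_diff.
rewrite (minn_idPl iT) (minn_idPl (leq_trans (leq_subr M i) iT)).
by case: ifP => _; lra.
Qed.

Lemma coef_window_small (R : realType) (A B : set nat) (M T i : nat) :
  `|((gen_poly R A T - gen_poly R B T) * window R M)`_i| <= M%:R.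
Proof.
rewrite mulrC coefM; apply: le_trans (ler_norm_sum _ _ _) _.
have -> : M%:R = \sum_(j < M) 1 :> R by rewrite sumr_const card_ord.
have le1 : (M <= (M + i).+1)%N by lia.
have le2 : (i.+1 <= (M + i).+1)%N by lia.
rewrite (big_ord_widen _ (fun=> 1) le1).
rewrite (big_ord_widen _ (fun j => `|(window R M)`_j * (gen_poly R A T - gen_poly R B T)`_(i - j)|) le2).
rewrite big_mkcond [leRHS]big_mkcond; apply: ler_sum => j _.
rewrite coef_poly; case: (ltnP j M) => jM; last by case: ifP; rewrite ?mul0r ?normr0.
case: ifP => // _; rewrite mul1r coefB !coef_gen_poly.
by do 2 case: (_ && _); rewrite ?subrr ?sub0r ?subr0 ?normrN ?normr1 ?normr0.
Qed.

(** Only the coefficients of degree greater than [T] feel the truncation; there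
    are [M] of them and each is at most [M].  The exponents [p = 0] and [p = 1]
    give the norms of the polynomial and of its image by [theta]. *)
Lemma wnorm2_window_diff (R : realType) (r : R) (A B : set nat) (M T p : nat) :
  0 <= r <= 1 ->
  \sum_(i < (T + M).+1) i%:R ^+ (2 * p) *
     (((gen_poly R A T - gen_poly R B T) * window R M)`_i) ^+ 2 * r ^+ (2 * i)
  <= \sum_(i < T.+1) i%:R ^+ (2 * p) * (window_diff R A B M i) ^+ 2 * (r ^+ 2) ^+ i
     + ((T + M)%:R ^+ (2 * p) * M%:R ^+ 3 * r ^+ T).
Proof.
move=> /andP[r0 r1]; rewrite -addSn big_split_ord /=; apply: lerD.
  by apply: ler_sum => i _; rewrite coef_window_diff -1?ltnS // (exprM r).
have -> : (T + M)%:R ^+ (2 * p) * M%:R ^+ 3 * r ^+ T =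
  \sum_(i < M) (T + M)%:R ^+ (2 * p) * M%:R ^+ 2 * r ^+ T :> R.
  by rewrite sumr_const card_ord -mulr_natl; ring.
apply: ler_sum => i _; apply: ler_pM.
- by apply: mulr_ge0; [exact: exprn_ge0|exact: sqr_ge0].
- exact: exprn_ge0.
- apply: ler_pM; [exact: exprn_ge0|exact: sqr_ge0| |].
    by rewrite lerXn2r ?nnegrE // ler_nat; have := ltn_ord i; lia.
  by rewrite -real_normK ?num_real // lerXn2r ?nnegrE // coef_window_small.
- by rewrite ler_wiXn2l //; lia.
Qed.

(** The right-hand side of [circle_inequality] at the scale [N = (q M)^2],
    [mu^2 = M], where [x = q M]. Apart from the terms in [Ca], which carry the
    extra factor [q^2 e^2], each term is at most a multiple of [N M^2] that is
    independent of [q]. *)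
Lemma error_terms_le (R : realType) (c e Ca Nr Nb q M N mu x : R) :
  0 <= c -> 0 <= e <= 1 -> 1 <= q -> 1 <= mu -> mu ^+ 2 = M -> x = q * M -> N = x ^+ 2 ->
  Nr * Nb ^+ 2 = N -> 3 * Ca * q ^+ 2 * e ^+ 2 <= 1 ->
  4 * (c * (M ^+ 2 * (2 * x) ^+ 2 + M ^+ 2 * 1 + 2 * (M ^+ 2 * (2 * x * mu))) +
     (3 * (M * mu * (e * mu ^+ 3)) + 2 * (mu * (e * N * mu ^+ 3))) + 1) +
  (2 * (Ca * Nr * (e * Nb * (e * N * Nb))) + Ca * N * Nr * (e * Nb) ^+ 2)
  <= (36 * c + 25) * (N * M ^+ 2).
Proof.
move=> c0 /andP[e0 e1] q1 mu1 muM xE NE NrNb eq2.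
have mM : mu <= M by rewrite -muM expr2 ler_peMr // (le_trans ler01).
have M1 : 1 <= M by apply: le_trans mM.
have Mx : M <= x by rewrite xE ler_peMl // (le_trans ler01).
have x1 : 1 <= x by apply: le_trans Mx.
have N1 : 1 <= N by rewrite NE exprn_ege1.
have xN : x * mu <= N by rewrite NE expr2 ler_wpM2l ?(le_trans ler01) // (le_trans mM).
have MN : M <= N by rewrite NE expr2 (le_trans Mx) // ler_peMr // (le_trans ler01).
have M2 : 1 <= M ^+ 2 by rewrite exprn_ege1.
pose Y := N * M ^+ 2.
have Y1 : 1 <= Y by rewrite -[1]mulr1; apply: ler_pM.
have a1 : M ^+ 2 * (2 * x) ^+ 2 = 4 * Y by rewrite /Y NE; ring.
have a2 : M ^+ 2 * 1 <= Y by rewrite mulr1 /Y ler_peMl // (le_trans ler01).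
have a3 : M ^+ 2 * (2 * x * mu) <= 2 * Y.
  rewrite /Y (_ : _ * (2 * x * mu) = 2 * (x * mu * M ^+ 2)); last by ring.
  by rewrite ler_pM2l // ler_wpM2r // (le_trans ler01).
have a4 : M * mu * (e * mu ^+ 3) <= Y.
  rewrite (_ : _ * (e * _) = e * (M * M ^+ 2)); last by rewrite -muM; ring.
  rewrite -[leRHS]mul1r; apply: ler_pM => //.
    by rewrite mulr_ge0 ?exprn_ge0 // (le_trans ler01).
  by rewrite /Y ler_wpM2r // (le_trans ler01).
have a5 : mu * (e * N * mu ^+ 3) <= Y.
  rewrite (_ : _ * (e * _ * _) = e * Y); last by rewrite /Y -muM; ring.
  by rewrite ler_piMl // (le_trans ler01).
have a6 : 2 * (Ca * Nr * (e * Nb * (e * N * Nb))) + Ca * N * Nr * (e * Nb) ^+ 2 <= Y.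
  have -> : 2 * (Ca * Nr * (e * Nb * (e * N * Nb))) + Ca * N * Nr * (e * Nb) ^+ 2
    = 3 * Ca * e ^+ 2 * N * (Nr * Nb ^+ 2) by ring.
  rewrite NrNb {2}NE xE (_ : _ * _ = (3 * Ca * q ^+ 2 * e ^+ 2) * Y); last by rewrite /Y; ring.
  by rewrite ler_piMl // (le_trans ler01).
have cY : c * (M ^+ 2 * (2 * x) ^+ 2 + M ^+ 2 * 1 + 2 * (M ^+ 2 * (2 * x * mu))) <= c * (9 * Y).
  by apply: ler_wpM2l => //; lra.
rewrite -/Y mulrDl; lra.
Qed.

(** The upper bound of [circle_inequality] confronted with the lower bound of
    [diagonal_lower_bound] at one scale. The window length [M] is an even square
    so that [M / 2] and [sqrt M] are integers, and [N] is a square so that its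
    power of exponent 3/2 is an integral power. The hypothesis on [j <= 4] is the
    conclusion of [block_sum] with a single constant [Kb]: [j] is the degree of
    the weight, at most 2, plus the degree of the growth, at most 2. *)
Lemma scale_inequality (R : realType) (k : nat) (A : 'I_k.+2 -> set nat)
    (c beta e C Kb Ca c' c1 : R) (a b : set nat) (rest : 'I_k -> set nat)
    (K q m M l N : nat) :
  a = A ord0 -> b = A (lift ord0 ord0) -> rest = (fun i => A (lift ord0 (lift ord0 i))) ->
  0 < c -> 0 < beta <= 1 / 2 -> 0 < C -> 0 < Kb -> 0 < c' ->
  Ca = 4 * Kb * C -> c1 = c' * (1 / 2) ^+ (2 * K.+1) / 2 ->
  (0 < q)%N -> 0 < e <= 1 -> 3 * Ca * q%:R ^+ 2 * e ^+ 2 <= 1 ->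
  (0 < m)%N -> M = ((2 * m) ^ 2)%N -> l = (2 * m ^ 2)%N -> N = ((q * M) ^ 2)%N ->
  (forall j, (0 < j <= 4)%N -> forall (rho B : R) (N p q : nat) (w : nat -> R),
    0 <= rho <= 1 -> rho ^+ N <= 1 / 2 -> (0 < N)%N -> (forall n, 0 <= w n) ->
    (p + q)%N = j ->
    (forall m, \sum_(n < m.+1 * N) w n <= m.+1%:R ^+ q * B) ->
    forall T, \sum_(n < T) n%:R ^+ p * w n * rho ^+ n <= Kb * N%:R ^+ p * B) ->
  (forall X, (N <= X)%N ->
     \sum_(j < X) ((rep_count A j)%:R - c * j%:R) ^+ 2 <=
       (e ^+ 2 / (Kb * q%:R ^+ 3)) * X%:R `^ (3 / 2)) ->
  (forall X, (N <= X)%N ->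
     \sum_(i < X) window_diff R a b M i ^+ 2 <=
       (e ^+ 2 / (2 * Kb)) * X%:R `^ (2 * beta)) ->
  (forall n, (0 < n)%N -> (rep_count rest n)%:R <= C * n%:R `^ (1 - 2 * beta)) ->
  c' * l%:R `^ (1 - 2 * beta) <= (rep_count rest l)%:R ->
  N%:R `^ beta <= (count_upto a (K * N))%:R - (count_upto a N)%:R :> R ->
  c1 * q%:R `^ (2 * beta) <= 36 * c + 25.
Proof.
move=> aE bE restE c0 /andP[b0 b1] C0 Kb0 c'0 CaE c1E q0 /andP[e0 e1] eq2 m1 ME lE NE blk HV HE HRu HRl HA.
have Ca0 : 0 < Ca by rewrite CaE !mulr_gt0.
have c10 : 0 < c1 by rewrite c1E divr_gt0 // mulr_gt0 // exprn_gt0 // divr_gt0.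
have q1 : 1 <= q%:R :> R by rewrite ler1n.
have Ml : M = (2 * l)%N by rewrite ME lE expnMn mulnA.
have ml : (m <= l)%N by rewrite lE (leq_trans (leq_pmulr m m1)) // mulnn leq_pmull.
have lM : (l <= M)%N by rewrite Ml leq_pmull.
have mM : (m <= M)%N := leq_trans ml lM.
have M0 : (0 < M)%N := leq_trans m1 mM.
have MqM : (M <= q * M)%N by rewrite leq_pmull.
have MN : (M <= N)%N.
  by rewrite NE -mulnn (leq_trans MqM) // leq_pmulr // (leq_trans M0).
have N0 : (0 < N)%N := leq_trans m1 (leq_trans mM MN).
pose mu : R := (2 * m)%:R.
have muM : mu ^+ 2 = M%:R by rewrite /mu ME natrX.
have mu1 : 1 <= mu by rewrite /mu ler1n muln_gt0.
have NRE : N%:R = (q%:R * M%:R) ^+ 2 :> R by rewrite NE natrX natrM.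
have M1 : 1 <= M%:R :> R by rewrite ler1n.
have N1 : 1 <= N%:R :> R by rewrite ler1n.
pose x : R := q%:R * M%:R.
have x1 : 1 <= x by rewrite -[1]mulr1; apply: ler_pM.
have x0 : 0 <= x by exact: le_trans x1.
have N32 : N%:R `^ (3 / 2) = x ^+ 3.
  rewrite NRE -/x -(powR_mulrn 2) // -powRrM.
  rewrite (_ : 2%:R * (3 / 2) = 3%:R); last by field.
  exact: powR_mulrn.
pose Nb : R := N%:R `^ beta.
have Nb0 : 0 < Nb by rewrite powR_gt0 // (lt_le_trans ltr01).
have Nb1 : 1 <= Nb by have := powR_le2 (ltW b0) ler01 N1; rewrite powR1.
have N2b : N%:R `^ (2 * beta) = Nb ^+ 2.
  by rewrite mulrC powRrM (powR_mulrn 2) // powR_ge0.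
pose Nr : R := N%:R `^ (1 - 2 * beta).
have Nr0 : 0 < Nr by rewrite powR_gt0 // (lt_le_trans ltr01).
have NrNb : Nr * Nb ^+ 2 = N%:R.
  rewrite -N2b /Nr -powRD; last by apply/implyP => _; rewrite gt_eqF // (lt_le_trans ltr01).
  by rewrite subrK powRr1 // ler0n.
have Nlow : q%:R `^ (2 * beta) * l%:R <= Nb * l%:R `^ (1 - 2 * beta).
  have l0 : 0 < l%:R :> R by rewrite ltr0n; exact: leq_trans ml.
  have -> : Nb = q%:R `^ (2 * beta) * M%:R `^ (2 * beta).
    rewrite -powRM ?(le_trans ler01) //.
    by rewrite /Nb NRE -(powR_mulrn 2) // -powRrM.
  rewrite -mulrA; apply: ler_wpM2l; first exact: powR_ge0.
  apply: (@le_trans _ _ (l%:R `^ (2 * beta) * l%:R `^ (1 - 2 * beta))).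
    rewrite -powRD; last by apply/implyP => _; rewrite gt_eqF.
    by rewrite addrC subrK powRr1 // ltW.
  apply: ler_wpM2r; first exact: powR_ge0.
  apply: powR_le2; rewrite ?ler0n //; first by rewrite mulr_ge0 // ltW.
  by rewrite ler_nat.
have [r [rlt1 rN r2N rG]] := @radius_exists R N N0.
have [r0 r1'] := andP rlt1.
have r1 : r <= 1 := ltW r1'.
have r01 : 0 <= r <= 1 by rewrite r0 r1.
pose N2 := (K * N)%N.
pose D : R := 2 + (k.+2 + 2 + 2 * M)%:R * M%:R ^+ 2 * (3 + 3 * c) + M.+1%:R ^+ 2 * M%:R ^+ 3.
have D2 : 0 <= (k.+2 + 2 + 2 * M)%:R * M%:R ^+ 2 * (3 + 3 * c) :> R.
  by rewrite !mulr_ge0 ?exprn_ge0 // addr_ge0 // mulr_ge0 // ltW.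
have D3 : 0 <= M.+1%:R ^+ 2 * M%:R ^+ 3 :> R by rewrite mulr_ge0 ?exprn_ge0.
have D0 : 0 < D by rewrite /D -addrA ltr_pwDl // addr_ge0.
have ee0 : 0 < e ^+ 2 / 2 by rewrite divr_gt0 ?exprn_gt0.
have ee1 : e ^+ 2 / 2 <= 1.
  have e21 : e ^+ 2 <= 1 by rewrite exprn_ile1 // ltW.
  by rewrite ler_pdivrMr // mul1r (le_trans e21) // ler1n.
(* All errors of truncation are at most [D] times this power of [T + 1] times
   [r ^+ T]; so [T] is chosen to bring them below [e ^+ 2 / 2]. *)
have eD0 : 0 < e ^+ 2 / 2 / D by exact: divr_gt0.
have := poly_geo_small (k + 5)%N rlt1 eD0.
move=> [T0 HT].
pose T := (T0 + N2 + l)%N.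
have tl : D * (T.+1%:R ^+ (k + 5)%N * r ^+ T) <= e ^+ 2 / 2.
  by rewrite mulrC -ler_pdivlMr //; apply: HT; rewrite /T -addnA leq_addr.
pose tq : R := T.+1%:R ^+ (k + 5)%N * r ^+ T.
have tq0 : 0 <= tq by rewrite mulr_ge0 ?exprn_ge0.
have T1 : 1 <= T.+1%:R :> R by rewrite ler1n.
have tqj (j : nat) : (j <= k + 5)%N -> T.+1%:R ^+ j * r ^+ T <= tq.
  by move=> jk; rewrite ler_wpM2r ?exprn_ge0 // ler_weXn2l.
rewrite -/tq /D in tl.
have tlD : 2 * tq + (k.+2 + 2 + 2 * M)%:R * M%:R ^+ 2 * (3 + 3 * c) * tq +
    M.+1%:R ^+ 2 * M%:R ^+ 3 * tq <= e ^+ 2 / 2.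
  by rewrite -!mulrDl.
have tl2 := mulr_ge0 D2 tq0; have tl3 := mulr_ge0 D3 tq0.
pose G : {poly R} := window R T.+1.
pose J := ones_poly R T.
pose V := error_poly (rep_count A) c T.
pose Tl := tail_poly A c T.
pose T' := 'X * G ^+ 2 - theta J.
pose S := gen_poly R a T + gen_poly R b T.
pose E := gen_poly R a T - gen_poly R b T.
pose H := gen_prod R rest T.
pose P := gen_prod R A T.
have PE : (S ^+ 2 - E ^+ 2) * H = 4%:R%:P * P.
  rewrite /P !gen_prod_recl -aE -bE /S /E /H restE.
  by rewrite polyC_natr; ring.
have PV : P = c%:P * J + (1 - 'X) * V + Tl by rewrite /Tl /tail_poly -/P -/J -/V; ring.
have JE : theta J = 'X * G ^+ 2 - T' by rewrite /T'; ring.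
have S0 i : 0 <= S`_i by rewrite coefD addr_ge0 // gen_poly_ge0.
have H0 i : 0 <= H`_i by exact: gen_prod_ge0.
have n01 (p : {poly R}) : (size p <= T.+1)%N -> (forall i, 0 <= p`_i <= 1) ->
    wnorm2 r p <= (2 * x) ^+ 2.
  move=> sp p01; rewrite (wnorm2E r sp).
  apply: (@le_trans _ _ (\sum_(i < T.+1) r ^+ (2 * i))).
    apply: ler_sum => i _; rewrite ler_piMl ?exprn_ge0 //.
    by have /andP[? ?] := p01 i; rewrite exprn_ile1.
  apply: le_trans (rG _) _; rewrite exprMn -NRE ler_wpM2r //.
  by rewrite expr2 ler_peMr // ler1n.
have nG : wnorm2 r G <= (2 * x) ^+ 2.
  by apply: n01 => [|i]; [exact: size_poly|rewrite coef_poly; case: ifP => _; rewrite ?ler01 lexx].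
have nJ : wnorm2 r J <= (2 * x) ^+ 2.
  apply: n01 => [|i]; first exact: size_poly.
  by rewrite coef_poly; case: ifP => _; rewrite ?ler01 ?lexx // ler0n lern1 leq_b1.
pose BV := e ^+ 2 / (Kb * q%:R ^+ 3) * x ^+ 3.
have q0R : 0 < q%:R :> R by rewrite ltr0n.
have BVE : Kb * BV = (e * mu ^+ 3) ^+ 2.
  rewrite /BV /x exprMn -muM; field; rewrite !gt_eqF //.
have r201 : 0 <= r ^+ 2 <= 1 by rewrite exprn_ge0 //= exprn_ile1.
have r2N' : (r ^+ 2) ^+ N <= 1 / 2 by rewrite -exprM.
have HBV (n : nat) : \sum_(j < n.+1 * N) ((rep_count A j)%:R - c * j%:R) ^+ 2 <= n.+1%:R ^+ 2 * BV.
  apply: le_trans (HV _ _) _; first by rewrite leq_pmull.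
  rewrite natrM powRM // N32 /BV mulrCA; apply: ler_wpM2r.
    by rewrite mulr_ge0 ?exprn_ge0 // divr_ge0 ?exprn_ge0 ?mulr_ge0 ?exprn_ge0 // ltW.
  by apply: powR_le_expr; rewrite ?ler1n // ler_pdivrMr // -natrM ler_nat.
have V2 n : 0 <= ((rep_count A n)%:R - c * n%:R) ^+ 2 by exact: sqr_ge0.
have sV : (size V <= T.+1)%N by exact: size_poly.
have nV : wnorm2 r V <= (e * mu ^+ 3) ^+ 2.
  have := @blk 2 isT (r ^+ 2) BV N 0%N 2%N _ r201 r2N' N0 V2 erefl HBV T.+1.
  rewrite expr0 mulr1 BVE; apply: le_trans.
  rewrite (wnorm2E r sV) le_eqVlt; apply/orP; left; apply/eqP/eq_bigr => i _.
  by rewrite coef_poly ltn_ord expr0 mul1r exprM.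
have nV1 : wnorm2 r (theta V) <= (e * N%:R * mu ^+ 3) ^+ 2.
  have := @blk 4 isT (r ^+ 2) BV N 2%N 2%N _ r201 r2N' N0 V2 erefl HBV T.+1.
  rewrite mulrAC BVE (_ : _ * N%:R ^+ 2 = (e * N%:R * mu ^+ 3) ^+ 2); last by ring.
  apply: le_trans.
  rewrite (wnorm2E r (leq_trans (size_theta V) sV)) le_eqVlt; apply/orP; left; apply/eqP/eq_bigr => i _.
  by rewrite coef_theta coef_poly ltn_ord -(mulr_natl (_ - _)) exprMn exprM.
have nT' : wnorm1 r T' <= 1.
  apply: le_trans (wnorm1_vanish_upto r01 (@vanish_upto_main R T)) _.
  apply: (@le_trans _ _ (2 * (T.+1%:R ^+ 2 * r ^+ T))).
    rewrite mulrC mulrA ler_wpM2r ?exprn_ge0 //; exact: wnorm1_main.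
  apply: le_trans ee1; apply: le_trans tlD; rewrite -addrA.
  have k2 : (2 <= k + 5)%N by rewrite addnC.
  by apply: le_trans (ler_wpM2l _ (tqj _ k2)) _ => //; rewrite lerDl addr_ge0.
have nT : wnorm1 r (theta (Tl * window R M ^+ 2)) <= 1.
  apply: le_trans (wnorm1_theta_tail A M T r01 (ltW c0)) _.
  have k5 : (k.+2 + 3 <= k + 5)%N by rewrite !addSnnS.
  apply: le_trans ee1; apply: le_trans tlD; rewrite [leRHS]addrAC.
  apply: le_trans (ler_wpM2l D2 (tqj _ k5)) _.
  by rewrite lerDr addr_ge0 // mulr_ge0.
have etail p : (p <= 1)%N -> (T + M)%:R ^+ (2 * p) * M%:R ^+ 3 * r ^+ T <= e ^+ 2 / 2.
  move=> p1; apply: le_trans tlD.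
  have k2 : (2 <= k + 5)%N by rewrite addnC.
  apply: (@le_trans _ _ (M.+1%:R ^+ 2 * M%:R ^+ 3 * tq)); last first.
    by rewrite lerDr addr_ge0 // mulr_ge0.
  apply: le_trans (ler_wpM2l D3 (tqj _ k2)).
  rewrite (_ : M.+1%:R ^+ 2 * M%:R ^+ 3 * (T.+1%:R ^+ 2 * r ^+ T) =
     (M.+1%:R * T.+1%:R) ^+ 2 * M%:R ^+ 3 * r ^+ T); last first.
    by move: (M.+1%:R : R) (T.+1%:R : R) (r ^+ T) => ? ? ?; ring.
  rewrite ler_wpM2r ?exprn_ge0 // ler_wpM2r ?exprn_ge0 // -natrM.
  apply: (@le_trans _ _ ((M.+1 * T.+1)%:R ^+ (2 * p))).
    by rewrite lerXn2r ?nnegrE // ler_nat mulSn leq_add ?leqnSn // leq_pmulr.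
  by apply: ler_weXn2l; rewrite ?ler1n // -[X in (_ <= X)%N]muln1 leq_mul2l.
have sE0 : (size (E * window R M)%R <= (T + M).+1)%N.
  apply: leq_trans (size_polyMleq _ _) _.
  have s1 : (size E <= T.+1)%N.
    by apply: leq_trans (size_polyD _ _) _; rewrite size_polyN geq_max !size_gen_poly.
  have s2 : (size (window R M) <= M)%N by exact: size_poly.
  by rewrite (leq_trans (leq_pred _)) // -addSn leq_add.
pose BE := e ^+ 2 / (2 * Kb) * Nb ^+ 2.
have BEE : Kb * BE = e ^+ 2 / 2 * Nb ^+ 2 by rewrite /BE; field; rewrite gt_eqF.
have HBE (n : nat) : \sum_(i < n.+1 * N) window_diff R a b M i ^+ 2 <= n.+1%:R ^+ 1 * BE.
  apply: le_trans (HE _ _) _; first by rewrite leq_pmull.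
  rewrite natrM powRM // N2b /BE mulrCA; apply: ler_wpM2r.
    by rewrite mulr_ge0 ?exprn_ge0 ?(ltW Nb0) // divr_ge0 ?exprn_ge0 ?mulr_ge0 // ltW.
  apply: powR_le_expr; rewrite ?ler1n //.
  by rewrite mulrC -ler_pdivlMr.
have W2 n : 0 <= window_diff R a b M n ^+ 2 by exact: sqr_ge0.
have Nb2 : 1 <= Nb ^+ 2 by rewrite exprn_ege1.
have nE : wnorm2 r (E * window R M) <= (e * Nb) ^+ 2.
  have h1 := @blk 1 isT (r ^+ 2) BE N 0%N 1%N _ r201 r2N' N0 W2 erefl HBE T.+1.
  rewrite expr0 mulr1 BEE in h1.
  have h2 := wnorm2_window_diff a b M T 0 r01.
  rewrite muln0 in h2; have h3 := etail 0%N isT; rewrite muln0 in h3.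
  have h4 := le_trans h2 (lerD h1 h3).
  rewrite (wnorm2E r sE0); under eq_bigr => i _ do rewrite -[_ ^+ 2]mul1r -(expr0 i%:R).
  apply: le_trans h4 _.
  rewrite exprMn [X in _ <= X * _](splitr (e ^+ 2)) mulrDl lerD2l.
  by rewrite ler_peMr // ltW.
have nE1 : wnorm2 r (theta (E * window R M)) <= (e * N%:R * Nb) ^+ 2.
  have h1 := @blk 3 isT (r ^+ 2) BE N 2%N 1%N _ r201 r2N' N0 W2 erefl HBE T.+1.
  rewrite mulrAC BEE in h1.
  have h2 := wnorm2_window_diff a b M T 1 r01.
  rewrite muln1 in h2; have h3 := etail 1%N isT; rewrite muln1 in h3.
  have h4 := le_trans h2 (lerD h1 h3).
  rewrite (wnorm2E r (leq_trans (size_theta _) sE0)).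
  under eq_bigr => i _ do rewrite coef_theta -(mulr_natl (E * window R M)`_i) exprMn.
  apply: le_trans h4 _.
  have -> : (e * N%:R * Nb) ^+ 2 = e ^+ 2 / 2 * Nb ^+ 2 * N%:R ^+ 2 + e ^+ 2 / 2 * (Nb ^+ 2 * N%:R ^+ 2).
    by field.
  rewrite lerD2l ler_peMr ?(ltW ee0) //.
  by rewrite (le_trans Nb2) // ler_peMr ?exprn_ege1 // (le_trans ler01).
have s01 : 0 <= 1 - 2 * beta <= 1.
  by rewrite subr_ge0 gerBl mulr_ge0 ?(ltW b0) // mulrC -ler_pdivlMr // b1.
have [s0 s1] := andP s01.
have HBH (n : nat) : \sum_(i < n.+1 * (2 * N)) H`_i <= n.+1%:R ^+ 1 * (2 * C * Nr).
  have X0 : (0 < n.+1 * (2 * N))%N by rewrite !muln_gt0.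
  apply: (@le_trans _ _ (psum H (n.+1 * (2 * N)))).
    by rewrite /psum big_ord_recr /= lerDl.
  apply: le_trans (psum_gen_prod_le R rest _ _) _; apply: le_trans (HRu _ X0) _.
  rewrite !natrM !powRM // -/Nr (_ : n.+1%:R ^+ 1 * (2 * C * Nr) = C * (n.+1%:R ^+ 1 * (2 * Nr))); last by ring.
  apply: ler_wpM2l; first exact: ltW.
  apply: ler_pM; rewrite ?mulr_ge0 ?powR_ge0 //; first by apply: powR_le_expr; rewrite ?ler1n.
  apply: ler_wpM2r; first exact: ltW.
  by rewrite -[leRHS]expr1; apply: powR_le_expr; rewrite ?ler1n.
have N20 : (0 < 2 * N)%N by rewrite muln_gt0.
have sH := size_gen_prod R rest T.
have nH : wnorm1 r H <= Ca * Nr.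
  have := @blk 1 isT r (2 * C * Nr) (2 * N)%N 0%N 1%N _ r01 r2N N20 H0 erefl HBH (k * T).+1.
  rewrite expr0 mulr1 => h; apply: le_trans (le_trans h _).
    rewrite (wnorm1E r sH) le_eqVlt; apply/orP; left; apply/eqP/eq_bigr => i _.
    by rewrite expr0 mul1r ger0_norm.
  rewrite CaE (_ : 4 * Kb * C * Nr = Kb * (2 * C * Nr) + Kb * (2 * C * Nr)); last by ring.
  by rewrite lerDl !mulr_ge0 // ltW.
have nH1 : wnorm1 r (theta H) <= Ca * N%:R * Nr.
  have := @blk 2 isT r (2 * C * Nr) (2 * N)%N 1%N 1%N _ r01 r2N N20 H0 erefl HBH (k * T).+1.
  move=> h; apply: le_trans (le_trans h _).
    rewrite (wnorm1E r (leq_trans (size_theta _) sH)) le_eqVlt; apply/orP; left; apply/eqP/eq_bigr => i _.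
    by rewrite expr1 coef_theta normrMn ger0_norm // -[_ *+ i]mulr_natl.
  by rewrite CaE natrM le_eqVlt; apply/orP; left; apply/eqP; ring.
have g0 : 0 <= 2 * x by rewrite mulr_ge0.
have mu0 : 0 <= mu by rewrite /mu.
have v0 : 0 <= e * mu ^+ 3 by rewrite mulr_ge0 ?exprn_ge0 // ltW.
have v10 : 0 <= e * N%:R * mu ^+ 3 by rewrite !mulr_ge0 ?exprn_ge0 // ltW.
have eN0 : 0 <= e * Nb by rewrite mulr_ge0 // ltW.
have eN10 : 0 <= e * N%:R * Nb by rewrite !mulr_ge0 // ltW.
have upper := @circle_inequality R r c mu (2 * x) (e * mu ^+ 3) (e * N%:R * mu ^+ 3) 1 1
  (e * Nb) (e * N%:R * Nb) (Ca * Nr) (Ca * N%:R * Nr) M S E H P V Tl J G T'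
  r01 (ltW c0) mu0 muM g0 v0 v10 eN0 eN10 PE PV JE nG nJ nV nV1 nT' nT nE nE1 nH nH1 S0 H0 (N2 + 2 * l)%N.
rewrite /= in upper.
have AS i : (gen_poly R a T)`_i <= S`_i by rewrite coefD lerDl gen_poly_ge0.
have K0 : (0 < K)%N.
  case: (posnP K) => // K0; move: HA; rewrite leNgt K0 mul0n => /negP; case.
  by apply: le_lt_trans Nb0; rewrite subr_le0 ler_nat count_upto_mono.
have N12 : (N <= N2 <= T)%N.
  by rewrite /N2 leq_pmull //= /T addnAC leq_addl.
have sE : S * window R M = S * window R (2 * l) by rewrite Ml.
have lower := @diagonal_lower_bound R r a S H N N2 l T (N2 + 2 * l) r01 AS H0 N12 (leqnn _) _ sE.
have := le_trans (ler_wpM2l (ler0n R 2) lower) upper.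
have low2 : 2 * c1 * q%:R `^ (2 * beta) * (N%:R * M%:R ^+ 2) / 2 <=
  2 * (((count_upto a N2)%:R - (count_upto a N)%:R) * psum H l *
  (l%:R * (N%:R * r ^+ (2 * (N2 + 2 * l))))).
  have lT : (l <= T)%N by rewrite /T leq_addl.
  have -> : psum H l = (rep_count rest l)%:R by exact: psum_gen_prod.
  pose h : R := (1 / 2) ^+ (2 * K.+1).
  have h0 : 0 <= h by rewrite exprn_ge0.
  have rh : h <= r ^+ (2 * (N2 + 2 * l)).
    apply: (@le_trans _ _ (r ^+ (N * (2 * K.+1)))).
      by rewrite exprM lerXn2r ?nnegrE ?exprn_ge0.
    by rewrite ler_wiXn2l // (mulnCA N) leq_mul2l /= mulnS addnC leq_add // -?Ml // /N2 mulnC.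
  have -> : 2 * c1 * q%:R `^ (2 * beta) * (N%:R * M%:R ^+ 2) / 2 =
      2 * ((c' * (q%:R `^ (2 * beta) * l%:R)) * (l%:R * (N%:R * h))).
    by rewrite c1E -/h Ml natrM; field.
  rewrite ler_pM2l //; apply: ler_pM; rewrite ?mulr_ge0 ?powR_ge0 // ?(ltW c'0) //.
    apply: (@le_trans _ _ (c' * (Nb * l%:R `^ (1 - 2 * beta)))); first by rewrite ler_pM2l.
    by rewrite mulrCA; apply: ler_pM => //; rewrite ?mulr_ge0 ?powR_ge0 // ltW.
  by do 2 apply: ler_wpM2l => //.
move=> fin; have {fin low2} := le_trans low2 fin.
have up2 : 4 *
  (c *
   (M%:R ^+ 2 * (2 * x) ^+ 2 + M%:R ^+ 2 * 1 +
    2 * (M%:R ^+ 2 * (2 * x * mu))) +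
   (3 * (M%:R * mu * (e * mu ^+ 3)) +
    2 * (mu * (e * N%:R * mu ^+ 3))) + 1) +
  (2 * (Ca * Nr * (e * Nb * (e * N%:R * Nb))) +
   Ca * N%:R * Nr * (e * Nb) ^+ 2) <= (36 * c + 25) * (N%:R * M%:R ^+ 2).
  apply: (@error_terms_le _ c e Ca Nr Nb q%:R M%:R N%:R mu x) => //; first exact: ltW.
  by rewrite ltW.
move=> fin; have {fin up2} := le_trans fin up2.
have Y0 : 0 < N%:R * M%:R ^+ 2 :> R by rewrite mulr_gt0 ?exprn_gt0 // (lt_le_trans ltr01).
rewrite (_ : 2 * c1 * _ * _ / 2 = (c1 * q%:R `^ (2 * beta)) * (N%:R * M%:R ^+ 2)); last by field.
by rewrite ler_pM2r.
Qed.

(** The parameters are chosen in the order [q], [e], [m]: first [q] defeats the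
    constant [36 c + 25] of [scale_inequality], then [e] makes the terms in
    [q^2 e^2] at most 1, and finally [m] is large enough for the asymptotic
    hypotheses to hold at the scales [l] and [N]. *)
Lemma no_small_error (R : realType) (k : nat) (A : 'I_k.+2 -> set nat) (c beta : R)
    (a b : set nat) (rest : 'I_k -> set nat) :
  a = A ord0 -> b = A (lift ord0 ord0) -> rest = (fun i => A (lift ord0 (lift ord0 i))) ->
  0 < c -> 0 < beta <= 1 / 2 ->
  (forall e : R, 0 < e -> exists X0, forall X, (X0 <= X)%N ->
     \sum_(j < X) ((rep_count A j)%:R - c * j%:R) ^+ 2 <= e * X%:R `^ (3 / 2)) ->
  (forall e : R, 0 < e -> exists X0, forall X M, (X0 <= X)%N ->
     \sum_(i < X) window_diff R a b M i ^+ 2 <= e * X%:R `^ (2 * beta)) ->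
  (exists2 C : R, 0 < C & forall n, (0 < n)%N ->
     (rep_count rest n)%:R <= C * n%:R `^ (1 - 2 * beta)) ->
  (exists2 c' : R, 0 < c' & exists n0, forall n, (n0 <= n)%N ->
     c' * n%:R `^ (1 - 2 * beta) <= (rep_count rest n)%:R) ->
  (exists K n0, forall n, (n0 <= n)%N ->
     n%:R `^ beta <= (count_upto a (K * n))%:R - (count_upto a n)%:R :> R) ->
  False.
Proof.
move=> aE bE restE c0 /andP[b0 b1] HV HE [C C0 HRu] [c' c'0 [nl HRl]] [K [na HA]].
have [K1 K10 B1] := block_sum R 1.
have [K2 K20 B2] := block_sum R 2.
have [K3 K30 B3] := block_sum R 3.
have [K4 K40 B4] := block_sum R 4.
pose Kb := K1 + K2 + K3 + K4.
have Kb0 : 0 < Kb by rewrite /Kb; lra.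
pose Ca := 4 * Kb * C.
have Ca0 : 0 < Ca by rewrite /Ca !mulr_gt0.
pose c1 := c' * (1 / 2) ^+ (2 * K.+1) / 2.
have c10 : 0 < c1 by rewrite /c1 divr_gt0 // mulr_gt0 // exprn_gt0 // divr_gt0.
have [q0 Hq] := @powR_unbounded R (2 * beta) ((36 * c + 26) / c1) (mulr_gt0 (ltr0Sn _ _) b0).
pose q := q0.+1.
have {}Hq : 36 * c + 26 <= c1 * q%:R `^ (2 * beta).
  by rewrite [c1 * _]mulrC -ler_pdivrMr //; apply: Hq.
have q1 : 1 <= q%:R :> R by rewrite ler1n.
(* As [e <= 1], bounding [q ^+ 2 * e] is enough to bound [q ^+ 2 * e ^+ 2]. *)
pose e := (3 * Ca * q%:R ^+ 2 + 1)^-1.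
have q20 : 0 <= q%:R ^+ 2 :> R by exact: sqr_ge0.
have den0 : 0 < 3 * Ca * q%:R ^+ 2 + 1.
  by rewrite ltr_wpDl // mulr_ge0 // mulr_ge0 // ltW.
have e0 : 0 < e by rewrite invr_gt0.
have e1 : e <= 1 by rewrite invf_le1 // lerDr mulr_ge0 // mulr_ge0 // ltW.
have eq1 : 3 * Ca * q%:R ^+ 2 * e <= 1 by rewrite ler_pdivrMr // mul1r lerDl.
have eq2 : 3 * Ca * q%:R ^+ 2 * e ^+ 2 <= 1.
  apply: le_trans eq1; apply: ler_wpM2l; first by rewrite mulr_ge0 // mulr_ge0 // ltW.
  by rewrite expr2 ler_piMr // ltW.
have [X1 HX1] : exists X0, forall X, (X0 <= X)%N ->
     \sum_(j < X) ((rep_count A j)%:R - c * j%:R) ^+ 2 <= (e ^+ 2 / (Kb * q%:R ^+ 3)) * X%:R `^ (3 / 2).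
  by apply: HV; rewrite divr_gt0 ?exprn_gt0 // mulr_gt0 // exprn_gt0 // (lt_le_trans ltr01).
have [X2 HX2] := HE (e ^+ 2 / (2 * Kb)) (divr_gt0 (exprn_gt0 2 e0) (mulr_gt0 (ltr0Sn _ 1) Kb0)).
have [m [m1 mX1 mX2 mnl mna]] : exists m,
    [/\ (0 < m)%N, (X1 <= m)%N, (X2 <= m)%N, (nl <= m)%N & (na <= m)%N].
  exists (X1 + X2 + nl + na).+1; rewrite ltn0Sn; split => //; apply/ltnW; rewrite ltnS.
  - by rewrite -!addnA leq_addr.
  - by rewrite -addnA (leq_trans (leq_addl X1 X2)) // leq_addr.
  - by rewrite addnAC leq_addl.
  - by rewrite leq_addl.
have ml : (m <= 2 * m ^ 2)%N by rewrite (leq_trans (leq_pmulr m m1)) // mulnn leq_pmull.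
have mM : (m <= (2 * m) ^ 2)%N by rewrite expnMn (leq_trans ml) // leq_mul2r orbT.
have mN : (m <= (q * (2 * m) ^ 2) ^ 2)%N.
  have mqM : (m <= q * (2 * m) ^ 2)%N by rewrite (leq_trans mM) // leq_pmull.
  by rewrite -[X in (_ <= X)%N]mulnn (leq_trans mqM) // leq_pmull // (leq_trans m1).
have blk (j : nat) : (0 < j <= 4)%N -> forall (rho B : R) (N p q : nat) (w : nat -> R),
    0 <= rho <= 1 -> rho ^+ N <= 1 / 2 -> (0 < N)%N -> (forall n, 0 <= w n) ->
    (p + q)%N = j ->
    (forall m, \sum_(n < m.+1 * N) w n <= m.+1%:R ^+ q * B) ->
    forall T, \sum_(n < T) n%:R ^+ p * w n * rho ^+ n <= Kb * N%:R ^+ p * B.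
  move=> j4 rho B N p q' w r01 rN N0 w0 pq HB T'.
  have BB0 : 0 <= B.
    by have := HB 0%N; rewrite expr1n mul1r; apply: le_trans; exact: sumr_ge0.
  have up K' : K' <= Kb -> K' * N%:R ^+ p * B <= Kb * N%:R ^+ p * B.
    by move=> KK; rewrite -!mulrA ler_wpM2r // mulr_ge0 ?exprn_ge0.
  case: j pq j4 => [|[|[|[|[|j]]]]] pq //= _.
  - by apply: le_trans (B1 rho B N p q' w r01 rN N0 w0 pq HB T') (up _ _); rewrite /Kb; lra.
  - by apply: le_trans (B2 rho B N p q' w r01 rN N0 w0 pq HB T') (up _ _); rewrite /Kb; lra.
  - by apply: le_trans (B3 rho B N p q' w r01 rN N0 w0 pq HB T') (up _ _); rewrite /Kb; lra.
  - by apply: le_trans (B4 rho B N p q' w r01 rN N0 w0 pq HB T') (up _ _); rewrite /Kb; lra.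
have b01 : 0 < beta <= 1 / 2 by rewrite b0 b1.
have e01 : 0 < e <= 1 by rewrite e0 e1.
have := @scale_inequality R k A c beta e C Kb Ca c' c1 a b rest K q m _ _ _
  aE bE restE c0 b01 C0 Kb0 c'0 erefl erefl (ltn0Sn _) e01 eq2 m1 erefl erefl erefl blk.
move=> /(_ _ _ HRu (HRl _ (leq_trans mnl ml)) (HA _ (leq_trans mna mN))) H.
have : c1 * q%:R `^ (2 * beta) <= 36 * c + 25.
  apply: H => X NX.
    by apply: HX1; rewrite (leq_trans mX1) // (leq_trans mN).
  by apply: HX2; rewrite (leq_trans mX2) // (leq_trans mN).
lra.
Qed.

(** * Growth of the counting functions *)

Lemma powR_nat_ge1 (R : realType) (s : R) n : 0 <= s -> (0 < n)%N -> 1 <= n%:R `^ s.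
Proof.
by move=> s0 n0; have := @powR_le2 R s 1 n%:R s0 ler01; rewrite powR1 ler1n; exact.
Qed.

Lemma powR_nat_le (R : realType) (s t : R) n : s <= t -> (0 < n)%N -> n%:R `^ s <= n%:R `^ t.
Proof. by move=> st n0; apply: ler_powR => //; rewrite ler1n. Qed.

(** Monotonicity extends an eventual bound to all positive integers, since the
    power is at least 1 there. *)
Lemma powR_bound_everywhere (R : realType) (f : nat -> R) (C s : R) (n0 : nat) :
  0 <= s -> (forall m n, (m <= n)%N -> f m <= f n) -> (forall n, 0 <= f n) ->
  (forall n, (n0 <= n)%N -> f n <= C * n%:R `^ s) ->
  exists2 C', 0 < C' & forall n, (0 < n)%N -> f n <= C' * n%:R `^ s.
Proof.
move=> s0 fm f0 fC; exists (`|C| + f n0 + 1); first by rewrite ltr_wpDl // addr_ge0.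
move=> n np; have n1 := powR_nat_ge1 s0 np.
have ns0 : 0 <= n%:R `^ s by exact: powR_ge0.
case: (leqP n0 n) => nn.
  apply: le_trans (fC _ nn) _; apply: ler_wpM2r => //.
  by have := ler_norm C; have := f0 n0; lra.
apply: le_trans (fm _ _ (ltnW nn)) _; apply: (@le_trans _ _ (f n0 * n%:R `^ s)).
  by rewrite ler_peMr.
by apply: ler_wpM2r => //; have := normr_ge0 C; lra.
Qed.

(** A tuple of sum at most [n] has a first entry, a second entry and a sum of
    the other entries that are all at most [n]. *)
Lemma rep_count_split_le (R : realType) k (A : 'I_k.+2 -> set nat) n :
  (rep_count A n)%:R <= (count_upto (A ord0) n)%:R *
    ((count_upto (A (lift ord0 ord0)) n)%:R *
     (rep_count (fun i => A (lift ord0 (lift ord0 i))) n)%:R) :> R.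
Proof.
rewrite -!psum_gen_prod_diag !gen_prod_recl.
have H0 := gen_prod_ge0 R (fun i => A (lift ord0 (lift ord0 i))) n.
apply: le_trans (psumM_le _ _ _) _ => [||] //; first exact: gen_poly_ge0.
  by apply: coefM_ge0 => //; exact: gen_poly_ge0.
rewrite psum_gen_poly minnn; apply: ler_wpM2l => //.
apply: le_trans (psumM_le _ _ _) _ => [||] //; first exact: gen_poly_ge0.
by rewrite psum_gen_poly minnn.
Qed.

(** Conversely, three parts that are at most [n] have a sum that is at most [3 n]. *)
Lemma rep_count_split_ge (R : realType) k (A : 'I_k.+2 -> set nat) n :
  (count_upto (A ord0) n)%:R *
    ((count_upto (A (lift ord0 ord0)) n)%:R *
     (rep_count (fun i => A (lift ord0 (lift ord0 i))) n)%:R) <= (rep_count A (n + (n + n)))%:R :> R.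
Proof.
have nT : (n <= n + (n + n))%N by rewrite leq_addr.
rewrite -(psum_gen_prod R (fun i => A (lift ord0 (lift ord0 i))) nT).
rewrite -psum_gen_prod_diag !gen_prod_recl.
have H0 := gen_prod_ge0 R (fun i => A (lift ord0 (lift ord0 i))) (n + (n + n)).
set T := (n + (n + n))%N in nT H0 *.
rewrite -{1}(minn_idPl nT) -psum_gen_poly -{2}(minn_idPl nT) -psum_gen_poly.
apply: le_trans (psumM_ge _ _ _ _); [|exact: gen_poly_ge0|]; last first.
  by apply: coefM_ge0 => //; exact: gen_poly_ge0.
apply: ler_wpM2l; first by apply: psum_ge0; exact: gen_poly_ge0.
by apply: psumM_ge => //; exact: gen_poly_ge0.
Qed.

Lemma rep_count_mono (R : realType) (k : nat) (A : 'I_k -> set nat) m n : (m <= n)%N ->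
  (rep_count A m)%:R <= (rep_count A n)%:R :> R.
Proof.
move=> mn; rewrite -(psum_gen_prod R A mn) -psum_gen_prod_diag.
by apply: psum_mono => // i; exact: gen_prod_ge0.
Qed.

Lemma sum_shift_le (R : realType) (f : nat -> R) M X : (forall i, 0 <= f i) ->
  \sum_(i < X) (if (M <= i)%N then f (i - M)%N else 0) <= \sum_(i < X) f i.
Proof.
move=> f0; have -> : \sum_(i < X) (if (M <= i)%N then f (i - M)%N else 0) = \sum_(i < (X - M)%N) f i.
  elim: X => [|X IH]; first by rewrite sub0n !big_ord0.
  rewrite big_ord_recr /= IH; case: leqP => MX.
    by rewrite subSn // [in RHS]big_ord_recr.
  have -> : (X - M = 0)%N by apply/eqP; rewrite subn_eq0 ltnW.
  have -> : (X.+1 - M = 0)%N by apply/eqP; rewrite subn_eq0.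
  by rewrite !big_ord0 addr0.
rewrite (big_ord_widen X f (leq_subr M X)) big_mkcond.
by apply: ler_sum => i _; case: ifP.
Qed.

(** By [sum_count_diff] there are [O(X^beta)] indices, and each of them
    contributes [o(X^(beta - alpha))]: if the [i]-th element of [b] is at most [X]
    then the [i]-th element of [a] is at most [2 X], as they are close. *)
Lemma sum_count_diff_small (R : realType) (a b : set nat) (alpha beta C : R) :
  0 < C -> 0 <= alpha -> alpha <= beta / 2 -> 0 < beta -> beta <= 1 / 2 ->
  (forall k, exists m, (k <= count_upto a m)%N) ->
  (forall k, exists m, (k <= count_upto b m)%N) ->
  (forall n, (0 < n)%N -> (count_upto a n)%:R <= C * n%:R `^ beta) ->
  (forall n, (0 < n)%N -> (count_upto b n)%:R <= C * n%:R `^ beta) ->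
  (forall e : R, 0 < e -> exists i0, forall i, (i0 <= i)%N ->
     `|(nth_elt a i)%:R - (nth_elt b i)%:R| <= e * (nth_elt a i)%:R `^ (beta - alpha)) ->
  forall e : R, 0 < e -> exists X0, forall X, (X0 <= X)%N ->
    \sum_(n < X) `|(count_upto a n)%:R - (count_upto b n)%:R| <= e * X%:R `^ (2 * beta - alpha).
Proof.
move=> C0 al0 al1 b0 b1 ua ub aC bC near e e0.
pose s := beta - alpha.
have s0 : 0 <= s by rewrite /s; lra.
have s1 : s <= 1 by rewrite /s; lra.
(* The bound 1/2 serves to compare the [i]-th elements of [a] and [b], the other
   one to sum over the indices. *)
pose e' := Num.min (1 / 2) (e / (4 * C)).
have e'0 : 0 < e' by rewrite lt_min divr_gt0 //= divr_gt0 // mulr_gt0.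
have e'1 : e' <= 1 / 2 by rewrite ge_min lexx.
have e'C : 4 * C * e' <= e.
  by rewrite mulrC -ler_pdivlMr ?mulr_gt0 // ge_min lexx orbT.
have [i0 Hi0] := near e' e'0.
pose S0 : R := \sum_(i < i0) `|(nth_elt a i.+1)%:R - (nth_elt b i.+1)%:R|.
have t0 : 0 < 2 * beta - alpha by lra.
have [X0 HX0] := @powR_unbounded R (2 * beta - alpha) (2 * S0 / e) t0.
exists (maxn X0 1) => X; rewrite geq_max => /andP[XX0 X1].
pose I := maxn (count_upto a X) (count_upto b X).
apply: (@le_trans _ _ (\sum_(n < X.+1) `|(count_upto a n)%:R - (count_upto b n)%:R|)).
  by rewrite big_ord_recr /= lerDl.
apply: le_trans (sum_count_diff R ua ub (leq_maxl _ _ : _ <= I)%N (leq_maxr _ _)) _.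
pose z := X%:R `^ s.
have z0 : 0 <= z by exact: powR_ge0.
have X0R : 1 <= X%:R :> R by rewrite ler1n.
have term i : (i < I)%N -> (i0 <= i)%N ->
    `|(nth_elt a i.+1)%:R - (nth_elt b i.+1)%:R| <= 2 * e' * z.
  move=> iI ii0.
  have cl := Hi0 i.+1 (leq_trans ii0 (leqnSn _)).
  have a2X : (nth_elt a i.+1)%:R <= 2 * X%:R :> R.
    move: iI; rewrite leq_max => /orP[|].
      by rewrite -nth_elt_le // -(ler_nat R) => h; lra.
    rewrite -nth_elt_le // -(ler_nat R) => h.
    case: (posnP (nth_elt a i.+1)) => [->|ap]; first by rewrite mulr_ge0.
    have ps : (nth_elt a i.+1)%:R `^ s <= (nth_elt a i.+1)%:R.
      by rewrite -[leRHS]expr1; apply: powR_le_expr; rewrite ?ler1n.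
    have h2 := ler_norm ((nth_elt a i.+1)%:R - (nth_elt b i.+1)%:R : R).
    have h3 : e' * (nth_elt a i.+1)%:R `^ s <= 1 / 2 * (nth_elt a i.+1)%:R.
      by apply: ler_pM; rewrite ?powR_ge0 // ltW.
    rewrite -/s in cl; lra.
  apply: le_trans cl _; rewrite -/s -mulrA mulrCA; apply: ler_wpM2l; first exact: ltW.
  apply: (@le_trans _ _ ((2 * X%:R) `^ s)); first by apply: powR_le2.
  rewrite powRM //; apply: ler_wpM2r => //.
  by rewrite -[leRHS]expr1; apply: powR_le_expr => //; rewrite ler1n.
apply: (@le_trans _ _ (S0 + I%:R * (2 * e' * z))).
  have -> : I%:R * (2 * e' * z) = \sum_(i < I) (2 * e' * z).
    by rewrite sumr_const card_ord mulr_natl.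
  have le1 : (I <= I + i0)%N by rewrite leq_addr.
  have le2 : (i0 <= I + i0)%N by rewrite leq_addl.
  rewrite (big_ord_widen _ (fun i => `|(nth_elt a i.+1)%:R - (nth_elt b i.+1)%:R|) le1).
  rewrite /S0 (big_ord_widen _ (fun i => `|(nth_elt a i.+1)%:R - (nth_elt b i.+1)%:R|) le2).
  rewrite (big_ord_widen _ (fun=> 2 * e' * z) le1) big_mkcond.
  rewrite [X in _ <= X + _]big_mkcond [X in _ <= _ + X]big_mkcond -big_split /=.
  have ez0 : 0 <= 2 * e' * z by rewrite mulr_ge0 // mulr_ge0 // ltW.
  apply: ler_sum => i _; case: (ltnP i I) => iI; case: (ltnP i i0) => ii0; rewrite ?addr0 ?add0r //.
    by rewrite lerDl.
  exact: term.
have IC : I%:R <= C * X%:R `^ beta.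
  by rewrite /I; case: (leqP (count_upto a X) (count_upto b X)) => _; [exact: bC|exact: aC].
have zz : X%:R `^ beta * z = X%:R `^ (2 * beta - alpha).
  rewrite /z -powRD; last by apply/implyP => _; rewrite gt_eqF // (lt_le_trans ltr01).
  by congr (_ `^ _); rewrite /s; ring.
have h1 : S0 <= e / 2 * X%:R `^ (2 * beta - alpha).
  by have := HX0 X XX0; rewrite ler_pdivrMr // => h; lra.
have h2 : I%:R * (2 * e' * z) <= e / 2 * X%:R `^ (2 * beta - alpha).
  apply: (@le_trans _ _ (C * X%:R `^ beta * (2 * e' * z))).
    by apply: ler_wpM2r => //; rewrite mulr_ge0 // mulr_ge0 // ltW.
  rewrite (_ : _ * (2 * e' * z) = 4 * C * e' / 2 * (X%:R `^ beta * z)); last by field.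
  by rewrite zz; apply: ler_wpM2r; rewrite ?powR_ge0 // ler_pM2r.
lra.
Qed.

(** The sum of squares is at most the maximum, which is [O(X^alpha)], times the
    sum of the absolute values, which is [o(X^(2 beta - alpha))]. *)
Lemma sum_window_diff_small (R : realType) (a b : set nat) (alpha beta C : R) :
  0 <= alpha -> alpha <= beta / 2 ->
  (forall n, (0 < n)%N -> `|(count_upto a n)%:R - (count_upto b n)%:R| <= C * n%:R `^ alpha) ->
  (forall e : R, 0 < e -> exists X0, forall X, (X0 <= X)%N ->
    \sum_(n < X) `|(count_upto a n)%:R - (count_upto b n)%:R| <= e * X%:R `^ (2 * beta - alpha)) ->
  forall e : R, 0 < e -> exists X0, forall X M, (X0 <= X)%N ->
    \sum_(i < X) window_diff R a b M i ^+ 2 <= e * X%:R `^ (2 * beta).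
Proof.
move=> al0 al1 dC Dsmall e e0.
pose C1 := `|C| + 1.
have C10 : 0 < C1 by rewrite ltr_wpDl.
have [X0 HX0] := Dsmall (e / (4 * C1)) (divr_gt0 e0 (mulr_gt0 (ltr0Sn _ _) C10)).
exists (maxn X0 1) => X M; rewrite geq_max => /andP[XX0 X1].
pose d n : R := (count_upto a n)%:R - (count_upto b n)%:R.
pose z := X%:R `^ alpha.
have z1 : 1 <= z by exact: powR_nat_ge1.
have z0 : 0 <= z by exact: le_trans z1.
have dz n : (n < X)%N -> `|d n| <= C1 * z.
  case: n => [|n] nX.
    apply: (@le_trans _ _ 1); last by rewrite -[1]mulr1; apply: ler_pM => //; rewrite lerDr.
    rewrite /d !count_upto0; case: (_ \in _); case: (_ \in _);
      by rewrite ?subrr ?subr0 ?sub0r ?normrN ?normr1 ?normr0.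
  apply: le_trans (dC _ _) _ => //; apply: ler_pM; rewrite ?powR_ge0 //.
    have := dC 1%N isT; rewrite powR1 mulr1; apply: le_trans; exact: normr_ge0.
    by rewrite (le_trans (ler_norm C)) // lerDl.
  by apply: powR_le2 => //; rewrite ler_nat ltnW.
pose sh i := (if (M <= i)%N then `|d (i - M)%N| else 0).
have key i : (i < X)%N -> window_diff R a b M i ^+ 2 <= 2 * C1 * z * (`|d i| + sh i).
  move=> iX; rewrite -real_normK ?num_real // expr2.
  have h : `|window_diff R a b M i| <= `|d i| + sh i.
    rewrite /window_diff /sh; apply: le_trans (ler_normB _ _) _; rewrite lerD2l.
    by case: ifP => _ //; rewrite normr0.
  have h2 : sh i <= C1 * z.
    rewrite /sh; case: ifP => _; last by rewrite mulr_ge0 // ltW.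
    by apply: dz; rewrite (leq_ltn_trans (leq_subr _ _)).
  have h3 := dz i iX.
  by apply: ler_pM => //; lra.
apply: (@le_trans _ _ (\sum_(i < X) 2 * C1 * z * (`|d i| + sh i))).
  by apply: ler_sum => i _; exact: key.
rewrite -mulr_sumr big_split /=.
have D1 := HX0 X XX0; rewrite -/d in D1.
have D2 : \sum_(i < X) sh i <= \sum_(i < X) `|d i|.
  by apply: (@sum_shift_le R (fun i => `|d i|) M X).
have zz : z * X%:R `^ (2 * beta - alpha) = X%:R `^ (2 * beta).
  rewrite /z -powRD; first by congr (_ `^ _); ring.
  by apply/implyP => _; rewrite gt_eqF // ltr0n.
apply: (@le_trans _ _ (2 * C1 * z * (2 * (e / (4 * C1) * X%:R `^ (2 * beta - alpha))))).
  apply: ler_wpM2l; first by rewrite mulr_ge0 // mulr_ge0 // ltW.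
  have D3 : \sum_(i < X) `|d i| <= e / (4 * C1) * X%:R `^ (2 * beta - alpha) by exact: D1.
  lra.
rewrite -zz le_eqVlt; apply/orP; left; apply/eqP.
by field; rewrite gt_eqF.
Qed.

(** A single term of the sum of squares already bounds the error at [n] by
    [o(n^(3/4))]. *)
Lemma rep_count_linear (R : realType) (rk : nat -> nat) (c : R) : 0 < c ->
  (forall e : R, 0 < e -> exists n0, forall n, (n0 <= n)%N ->
     sq_error rk c n <= e * n%:R `^ (3 / 2)) ->
  exists n0, forall n, (n0 <= n)%N -> c / 2 * n%:R <= (rk n)%:R <= 2 * c * n%:R.
Proof.
move=> c0 err; have [n0 Hn0] := err ((c / 2) ^+ 2) (exprn_gt0 2 (divr_gt0 c0 (ltr0Sn _ _))).
exists (maxn n0 1) => n; rewrite geq_max => /andP[nn n1].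
have n1R : 1 <= n%:R :> R by rewrite ler1n.
have h : ((rk n)%:R - c * n%:R) ^+ 2 <= (c / 2 * n%:R) ^+ 2.
  apply: le_trans (le_trans (Hn0 _ nn) _).
    by rewrite /sq_error big_ord_recr /= lerDr sumr_ge0 // => i _; exact: sqr_ge0.
  rewrite (exprMn _ (c / 2) n%:R); apply: ler_wpM2l; first exact: sqr_ge0.
  by apply: powR_le_expr => //; rewrite ler_pdivrMr // -natrM ler_nat.
have cn0 : 0 <= c / 2 * n%:R by rewrite mulr_ge0 // divr_ge0 // ltW.
move: h; rewrite -(real_normK (num_real ((rk n)%:R - _))) ler_pXn2r ?nnegrE // => h.
move: h; rewrite ler_norml => /andP[h1 h2]; apply/andP; split; lra.
Qed.

Lemma count_upto_unbounded (R : realType) (a : set nat) (s C : R) (n0 : nat) :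
  0 < s -> 0 < C ->
  (forall n, (n0 <= n)%N -> C * n%:R `^ s <= (count_upto a n)%:R) ->
  forall k, exists m, (k <= count_upto a m)%N.
Proof.
move=> s0 C0 H k; have [n1 H1] := @powR_unbounded R s (k%:R / C) s0.
exists (maxn n0 n1); rewrite -(ler_nat R).
apply: le_trans (H _ (leq_maxl _ _)).
by rewrite mulrC -ler_pdivrMr // H1 // leq_maxr.
Qed.

(** The counting function of [b] has the same order as that of [a], since the
    difference is [O(n^(beta / 2))]. The counts of [a], of [b] and of the sums
    over the remaining sets have a product of order [n], by [rep_count_linear],
    so the third one has order [n^(1 - 2 beta)]. For a large fixed [K], the upper
    bound at [n] and the lower bound at [K n] leave at least [n^beta] elements of
    [a] between [n] and [K n]. *)
Lemma erdos_fuchs_pair (R : realType) (k : nat) (A : 'I_k.+2 -> set nat)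
    (alpha beta c ca Ca Cd : R) (a b : set nat) (na : nat) :
  a = A ord0 -> b = A (lift ord0 ord0) ->
  0 < c -> 0 < beta <= 1 / 2 -> 0 <= alpha <= beta / 2 ->
  (forall e : R, 0 < e -> exists i0, forall i, (i0 <= i)%N ->
     `|(nth_elt a i)%:R - (nth_elt b i)%:R| <= e * (nth_elt a i)%:R `^ (beta - alpha)) ->
  (forall n, (0 < n)%N ->
     `|(count_upto a n)%:R - (count_upto b n)%:R| <= Cd * n%:R `^ alpha) ->
  0 < ca -> (forall n, (na <= n)%N -> ca * n%:R `^ beta <= (count_upto a n)%:R) ->
  (forall n, (na <= n)%N -> (count_upto a n)%:R <= Ca * n%:R `^ beta) ->
  (forall e : R, 0 < e -> exists n0, forall n, (n0 <= n)%N ->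
     sq_error (rep_count A) c n <= e * n%:R `^ (3 / 2)) ->
  False.
Proof.
move=> aE bE c0 b01 /andP[al0 al1] near dC ca0 alow aup err.
have [b0 b1] := andP b01.
pose rest := fun i => A (lift ord0 (lift ord0 i)).
have [nr Hr] := rep_count_linear c0 err.
have [C1 C10 aC1] : exists2 C', 0 < C' & forall n, (0 < n)%N -> (count_upto a n)%:R <= C' * n%:R `^ beta.
  apply: (powR_bound_everywhere (n0 := na) (C := Ca)) => //; first exact: ltW.
  by move=> m n mn; rewrite ler_nat count_upto_mono.
pose C := C1 + `|Cd|.
have C0 : 0 < C by rewrite ltr_pwDl.
have aC n : (0 < n)%N -> (count_upto a n)%:R <= C * n%:R `^ beta.
  move=> n0; apply: le_trans (aC1 n n0) _; apply: ler_wpM2r; first exact: powR_ge0.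
  by rewrite lerDl.
have dC' n : (0 < n)%N -> `|(count_upto a n)%:R - (count_upto b n)%:R| <= `|Cd| * n%:R `^ (beta / 2).
  move=> n0; apply: le_trans (dC n n0) _; apply: (@le_trans _ _ (`|Cd| * n%:R `^ alpha)).
    by apply: ler_wpM2r; [exact: powR_ge0|exact: ler_norm].
  by apply: ler_wpM2l => //; exact: powR_nat_le.
have bb n : (0 < n)%N -> n%:R `^ (beta / 2) <= n%:R `^ beta.
  by move=> n0; apply: powR_nat_le => //; lra.
have bC n : (0 < n)%N -> (count_upto b n)%:R <= C * n%:R `^ beta.
  move=> n0; have := dC' n n0; rewrite ler_norml => /andP[h1 h2].
  have h3 : `|Cd| * n%:R `^ (beta / 2) <= `|Cd| * n%:R `^ beta by apply: ler_wpM2l => //; exact: bb.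
  by have := aC1 n n0; rewrite /C mulrDl; lra.
have b20 : 0 < beta / 2 by lra.
have [n2 Hn2] := @powR_unbounded R (beta / 2) (`|Cd| / (ca / 2)) b20.
pose nb := maxn (maxn na n2) 1.
have blow n : (nb <= n)%N -> ca / 2 * n%:R `^ beta <= (count_upto b n)%:R.
  rewrite !geq_max => /andP[/andP[nan n2n] n1].
  have := dC' n n1; rewrite ler_norml => /andP[h1 h2].
  have h3 := Hn2 n n2n; rewrite ler_pdivrMr ?divr_gt0 // in h3.
  have h4 : `|Cd| * n%:R `^ (beta / 2) <= ca / 2 * n%:R `^ beta.
    have -> : n%:R `^ beta = n%:R `^ (beta / 2) * n%:R `^ (beta / 2).
      rewrite -powRD; first by congr (_ `^ _); field.
      by apply/implyP => _; rewrite gt_eqF // ltr0n.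
    rewrite mulrA; apply: ler_wpM2r; first exact: powR_ge0.
    by rewrite mulrC.
  by have := alow n nan; lra.
have ua := count_upto_unbounded b0 ca0 alow.
have ub := count_upto_unbounded b0 (divr_gt0 ca0 (ltr0Sn _ 1)) blow.
have Dsmall := sum_count_diff_small C0 al0 al1 b0 b1 ua ub aC bC near.
have HE := sum_window_diff_small al0 al1 dC Dsmall.
apply: (@no_small_error R k A c beta a b rest aE bE erefl c0 b01 _ HE).
- move=> e e0; have [n0 Hn0] := err e e0; exists n0 => X nX.
  apply: le_trans (Hn0 X nX); rewrite /sq_error big_ord_recr /= lerDl; exact: sqr_ge0.
- have pow2 n : (0 < n)%N -> n%:R `^ beta * (n%:R `^ beta * n%:R `^ (1 - 2 * beta)) = n%:R :> R.
    move=> n0; have nz : n%:R != 0 :> R by rewrite gt_eqF // ltr0n.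
    rewrite -!powRD; [|by apply/implyP..].
    by rewrite (_ : beta + _ = 1) ?powRr1 //; ring.
  apply: (@powR_bound_everywhere R (fun n => (rep_count rest n)%:R)
    (6 * c / (ca * (ca / 2))) _ (maxn (maxn na nb) (maxn nr 1))) => //.
  + by lra.
  + by move=> m n mn; exact: rep_count_mono.
  move=> n; rewrite !geq_max => /andP[/andP[nan nbn] /andP[nrn n1]].
  set y := n%:R `^ beta; have y0 : 0 < y by rewrite powR_gt0 // ltr0n.
  set z := n%:R `^ (1 - 2 * beta).
  have E : y * (y * z) = n%:R by exact: pow2.
  have h1 := rep_count_split_ge R A n; rewrite -aE -bE -/rest in h1.
  have h2 : (rep_count A (n + (n + n)))%:R <= 2 * c * (n + (n + n))%:R.
    by case/andP: (Hr (n + (n + n))%N (leq_trans nrn (leq_addr _ _))).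
  have h3 := le_trans h1 h2.
  have h4 : ca * y * (ca / 2 * y * (rep_count rest n)%:R) <= 6 * c * (y * (y * z)).
    rewrite E; apply: le_trans (le_trans h3 _).
      have ca20 : 0 <= ca / 2 by rewrite divr_ge0 // ltW.
      have alown := alow n nan; have blown : ca / 2 * y <= (count_upto b n)%:R by apply: blow; rewrite !geq_max.
      apply: ler_pM => //; last exact: ler_wpM2r.
        by rewrite mulr_ge0 // ltW.
      by apply: mulr_ge0 => //; apply: mulr_ge0 => //; exact: ltW.
    by rewrite !natrD; have := ler0n R n; nra.
  rewrite -(ler_pM2l (mulr_gt0 (mulr_gt0 ca0 y0) (mulr_gt0 (divr_gt0 ca0 (ltr0Sn R 1)) y0))).
  rewrite -mulrA (le_trans h4) // le_eqVlt; apply/orP; left; apply/eqP.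
  by field; rewrite gt_eqF.
- exists (c / 2 / (C * C)); first by rewrite divr_gt0 ?mulr_gt0 // invr_gt0.
  exists (maxn nr 1) => n; rewrite geq_max => /andP[nrn n1].
  have nz : n%:R != 0 :> R by rewrite gt_eqF // ltr0n.
  set z := n%:R `^ (1 - 2 * beta).
  pose y := n%:R `^ beta; have y0 : 0 < y by rewrite powR_gt0 // ltr0n.
  have E : y * (y * z) = n%:R.
    rewrite /y /z -!powRD; [|by apply/implyP..].
    by rewrite (_ : beta + _ = 1) ?powRr1 //; ring.
  have h1 := rep_count_split_le R A n; rewrite -aE -bE -/rest in h1.
  have /andP[h2 _] := Hr n nrn.
  have h3 := le_trans h2 h1.
  have h4 : c / 2 * (y * (y * z)) <= C * y * (C * y * (rep_count rest n)%:R).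
    rewrite E; apply: le_trans h3 _; apply: ler_pM => //; first exact: aC.
    by apply: ler_wpM2r => //; exact: bC.
  rewrite -(ler_pM2l (mulr_gt0 (mulr_gt0 C0 y0) (mulr_gt0 C0 y0))).
  apply: le_trans (_ : c / 2 * (y * (y * z)) <= _); last by rewrite -[leRHS]mulrA.
  by rewrite le_eqVlt; apply/orP; left; apply/eqP; field; rewrite gt_eqF.
- have [K HK] := @powR_unbounded R beta ((C + 1) / ca) b0.
  have {}HK := HK K.+1 (leqnSn K).
  exists K.+1, (maxn na 1) => n; rewrite geq_max => /andP[nan n1].
  have h1 := aC n n1.
  have h2 := alow (K.+1 * n)%N (leq_trans nan (leq_pmull _ (ltn0Sn _))).
  rewrite natrM powRM // in h2.
  rewrite ler_pdivrMr // in HK.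
  have h3 : (C + 1) * n%:R `^ beta <= ca * (K.+1%:R `^ beta * n%:R `^ beta).
    by rewrite mulrA; apply: ler_wpM2r; rewrite ?powR_ge0 // mulrC.
  lra.
Qed.

(** Two numbers of product of order [y^2] whose difference is [O(y)] both have
    order [y]. *)
Lemma sqrt_order_of_product (R : realType) (a b : set nat) (C c : R) (n0 : nat) :
  0 < c ->
  (forall n, (0 < n)%N ->
     `|(count_upto a n)%:R - (count_upto b n)%:R| <= C * n%:R `^ (1 / 2)) ->
  (forall n, (n0 <= n)%N ->
     c * n%:R <= (count_upto a n)%:R * (count_upto b n)%:R <= 12 * c * n%:R) ->
  exists ca Ca : R, exists na, [/\ 0 < ca,
    (forall n, (na <= n)%N -> ca * n%:R `^ (1 / 2) <= (count_upto a n)%:R) &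
    (forall n, (na <= n)%N -> (count_upto a n)%:R <= Ca * n%:R `^ (1 / 2))].
Proof.
move=> c0 dC ab.
pose D := `|C|; have D0 : 0 <= D by exact: normr_ge0.
pose s := Num.min 1 (c / (2 * (1 + D))).
have s0 : 0 < s by rewrite lt_min ltr01 divr_gt0 // mulr_gt0 // ltr_pwDl.
have s1 : s <= 1 by rewrite ge_min lexx.
have sc : s * (1 + D) <= c / 2.
  have h : s <= c / (2 * (1 + D)) by rewrite ge_min lexx orbT.
  have p : 0 < 1 + D by rewrite ltr_pwDl.
  apply: le_trans (ler_wpM2r (ltW p) h) _.
  by rewrite le_eqVlt; apply/orP; left; apply/eqP; field; rewrite gt_eqF.
exists s, (D + 12 * c + 1), (maxn n0 1); split=> // n; rewrite geq_max => /andP[nn n1].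
- have /andP[h1 h2] := ab n nn.
  have := dC n n1; set y := n%:R `^ (1 / 2) => d.
  have y1 : 1 <= y by apply: powR_nat_ge1 => //; lra.
  have yy : y * y = n%:R.
    rewrite /y -powRD; last by apply/implyP => _; rewrite gt_eqF // ltr0n.
    by rewrite (_ : 1 / 2 + 1 / 2 = 1) ?powRr1 //; field.
  have dD : `|(count_upto a n)%:R - (count_upto b n)%:R| <= D * y.
    by apply: le_trans d _; apply: ler_wpM2r; [lra|exact: ler_norm].
  move: dD; rewrite ler_norml => /andP[d1 d2].
  rewrite leNgt; apply/negP => lt.
  have u0 : 0 <= (count_upto a n)%:R :> R by [].
  have v0 : 0 <= (count_upto b n)%:R :> R by [].
  set u := (count_upto a n)%:R in h1 lt d1 d2 u0; set v := (count_upto b n)%:R in h1 d1 d2 v0.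
  have vle : v <= (s + D) * y by rewrite mulrDl; lra.
  have uv : u * v <= s * y * ((s + D) * y) by apply: ler_pM => //; exact: ltW.
  have e1 : s * y * ((s + D) * y) <= s * (1 + D) * (y * y).
    rewrite (_ : s * y * _ = s * (s + D) * (y * y)); last by ring.
    apply: ler_wpM2r; first by rewrite yy.
    by apply: ler_wpM2l; rewrite ?(ltW s0) // lerD2r.
  have e2 : s * (1 + D) * (y * y) <= c / 2 * (y * y) by apply: ler_wpM2r => //; rewrite yy.
  have e3 : 0 < c * (y * y) by rewrite !mulr_gt0 //; lra.
  rewrite -yy in h1; lra.
- have /andP[h1 h2] := ab n nn.
  have := dC n n1; set y := n%:R `^ (1 / 2) => d.
  have y1 : 1 <= y by apply: powR_nat_ge1 => //; lra.
  have yy : y * y = n%:R.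
    rewrite /y -powRD; last by apply/implyP => _; rewrite gt_eqF // ltr0n.
    by rewrite (_ : 1 / 2 + 1 / 2 = 1) ?powRr1 //; field.
  have dD : `|(count_upto a n)%:R - (count_upto b n)%:R| <= D * y.
    by apply: le_trans d _; apply: ler_wpM2r; [lra|exact: ler_norm].
  move: dD; rewrite ler_norml => /andP[d1 d2].
  rewrite leNgt; apply/negP => lt.
  set u := (count_upto a n)%:R in h2 lt d1 d2; set v := (count_upto b n)%:R in h2 d1 d2.
  have vge : (12 * c + 1) * y <= v by move: lt; rewrite !mulrDl mul1r; lra.
  have y0 : 0 <= y by exact: le_trans y1.
  have Dy : 0 <= D * y by exact: mulr_ge0.
  have cy : 0 <= 12 * c * y by rewrite mulr_ge0 // mulr_ge0 // ltW.
  have uge : y <= u by move: lt; rewrite !mulrDl mul1r; lra.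
  have uv : y * ((12 * c + 1) * y) <= u * v.
    by apply: ler_pM => //; rewrite ?mulr_ge0 ?addr_ge0 ?mulr_ge0 ?(ltW c0) //; lra.
  have : 0 < y * y by rewrite mulr_gt0 //; lra.
  rewrite -yy in h2; lra.
Qed.

(** * The theorem *)

Lemma eqo_nat (R : realType) (f g : nat -> R) : f =o_\oo g ->
  forall e : R, 0 < e -> exists n0, forall n, (n0 <= n)%N -> `|f n| <= e * `|g n|.
Proof. by move=> /eqoP fg e e0; have [n0 _ H] := fg e e0; exists n0. Qed.

Lemma eqTheta_nat (R : realType) (f g : nat -> R) : f =Theta_\oo g ->
  exists c1 c2 : R, exists n0, [/\ 0 < c1,
    (forall n, (n0 <= n)%N -> c1 * `|g n| <= `|f n|) &
    (forall n, (n0 <= n)%N -> `|f n| <= c2 * `|g n|)].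
Proof.
rewrite eqThetaE qualifE => /asboolP[[c1 c2] /= /andP[c10 _] [n0 _ H]].
by exists c1, c2, n0; split=> // n /H [].
Qed.

Lemma sq_error_small (R : realType) (rk : nat -> nat) (c : R) :
  sq_error rk c =o_\oo (fun n => n%:R `^ (3 / 2)) ->
  forall e : R, 0 < e -> exists n0, forall n, (n0 <= n)%N ->
     sq_error rk c n <= e * n%:R `^ (3 / 2).
Proof.
move=> /eqo_nat H e /H [n0 Hn0]; exists n0 => n /Hn0.
by rewrite [`|_ `^ _|]ger0_norm ?powR_ge0 //; apply: le_trans; exact: ler_norm.
Qed.

Lemma nth_elt_close (R : realType) (A B : set nat) (s : R) :
  (fun i => (nth_elt A i)%:R - (nth_elt B i)%:R : R) =o_\oo (fun i => (nth_elt A i)%:R `^ s) ->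
  forall e : R, 0 < e -> exists i0, forall i, (i0 <= i)%N ->
     `|(nth_elt A i)%:R - (nth_elt B i)%:R| <= e * (nth_elt A i)%:R `^ s.
Proof.
move=> /eqo_nat H e /H [n0 Hn0]; exists n0 => i /Hn0.
by rewrite [`|_ `^ _|]ger0_norm ?powR_ge0.
Qed.

Unset Implicit Arguments.

Theorem theorem3 (R : realType) :
  (forall (alpha : R) (A B : set nat),
     0 <= alpha <= 1 / 4 ->
     infinite_set A ->
     infinite_set B ->
     (fun i => (nth_elt A i)%:R - (nth_elt B i)%:R : R)
       =o_\oo (fun i => (nth_elt A i)%:R `^ (1 / 2 - alpha)) ->
     (exists C : R, forall n : nat, (1 <= n)%N ->
        `|(count_upto A n)%:R - (count_upto B n)%:R| <= C * n%:R `^ alpha) ->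
     ~ (exists2 c : R, 0 < c &
          sq_error (rep_count2 A B) c =o_\oo (fun n => n%:R `^ (3 / 2))))
  /\
  (forall (alpha beta : R) (k : nat) (A : 'I_k -> set nat) (i1 i2 : 'I_k),
     0 < beta <= 1 / 2 ->
     0 <= alpha <= beta / 2 ->
     (3 <= k)%N ->
     i1 = 0%N :> nat ->
     i2 = 1%N :> nat ->
     (forall i, A i !=set0) ->
     (fun i => (nth_elt (A i1) i)%:R - (nth_elt (A i2) i)%:R : R)
       =o_\oo (fun i => (nth_elt (A i1) i)%:R `^ (beta - alpha)) ->
     (exists C : R, forall n : nat, (1 <= n)%N ->
        `|(count_upto (A i1) n)%:R - (count_upto (A i2) n)%:R|
          <= C * n%:R `^ alpha) ->
     (fun n => (count_upto (A i1) n)%:R : R)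
       =Theta_\oo (fun n => n%:R `^ beta) ->
     ~ (exists2 c : R, 0 < c &
          sq_error (rep_count A) c =o_\oo (fun n => n%:R `^ (3 / 2)))).
Proof.
split.
  move=> alpha A B /andP[al0 al1] _ _ /nth_elt_close near [C dC] [c c0 /sq_error_small err].
  pose F : 'I_2 -> set nat := tnth [tuple A; B].
  have FA : A = F ord0 by [].
  have FB : B = F (lift ord0 ord0) by [].
  have rest1 n : (rep_count (fun i => F (lift ord0 (lift ord0 i))) n)%:R = 1 :> R.
    rewrite -psum_gen_prod_diag /gen_prod big_ord0 /psum big_ord_recl coef1 /= big1 ?addr0 // => i _.
    by rewrite coef1.
  have [n0 Hn0] := rep_count_linear c0 err.
  have b1 : 0 < (1 / 2 : R) <= 1 / 2 by apply/andP; split => //; lra.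
  have a1 : 0 <= alpha <= 1 / 2 / 2 by apply/andP; split => //; lra.
  have [||ca [Ca [na [ca0 low up]]]] :=
    @sqrt_order_of_product R A B `|C| (c / 2) n0 (divr_gt0 c0 (ltr0Sn _ 1)).
  - move=> n n1; apply: le_trans (dC n n1) _; apply: (@le_trans _ _ (`|C| * n%:R `^ alpha)).
      by apply: ler_wpM2r; [exact: powR_ge0|exact: ler_norm].
    by apply: ler_wpM2l => //; apply: powR_nat_le => //; lra.
  - move=> n nn.
    have h1 := rep_count_split_le R F n; rewrite rest1 mulr1 -FA -FB in h1.
    have h2 := rep_count_split_ge R F n; rewrite rest1 mulr1 -FA -FB in h2.
    have /andP[h3 _] := Hn0 n nn.
    have /andP[_ h4] := Hn0 (n + (n + n))%N (leq_trans nn (leq_addr _ _)).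
    rewrite !natrD in h4; apply/andP; split.
      exact: le_trans h3 h1.
    by apply: le_trans (le_trans h2 h4) _; lra.
  exact: (erdos_fuchs_pair FA FB c0 b1 a1 near dC ca0 low up err).
move=> alpha beta k A i1 i2 b01 a01 k3 i10 i21 _ near [C dC] th [c c0 /sq_error_small err].
case: k A i1 i2 k3 i10 i21 near dC th err => [|[|[|k]]] A i1 i2 //= _ i10 i21 near dC th err.
have E1 : i1 = ord0 by apply: val_inj.
have E2 : i2 = lift ord0 ord0 by apply: val_inj.
rewrite {}E1 {}E2 in near dC th.
have [c1 [c2 [n0 [c10 low up]]]] := eqTheta_nat th.
apply: (erdos_fuchs_pair (Ca := c2) (na := n0) (erefl _) (erefl _) c0 b01 a01
  (nth_elt_close near) dC c10 _ _ err).
  by move=> n /low; rewrite !ger0_norm ?powR_ge0.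
by move=> n /up; rewrite !ger0_norm ?powR_ge0.
Qed.
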